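(* There exist absolute constants $\kappa_1,\kappa_2>0$ such that for all $c_1\ge\kappa_1$, $c_2\ge\kappa_2$, $p\in(0,2]$ and $\alpha>1/p-1/2$ there exists a constant $C>0$, depending only on $\alpha,p,c_1,c_2$, with the following property. Let $\rho$ be the unique solution in $(1,\infty)$ of $\rho\log\rho=2\alpha+1$. For all integers $N\ge1$, $r\ge2$, with $n=2^N$, and all $R>0$ such that $nR^2\ge\log n>1$ and $n^\alpha>R\sqrt\rho$, the estimator $\tilde s$ computed with the EH strategy (with constants $c_1,c_2$ in the penalty) satisfies $$\sup_{s\in\mathcal{P}(R,\alpha,p)}\mathbb{E}_s\|s-\tilde s\|^2\le C\left[1+\log\left(\frac{n^\alpha}{R}\right)\right]^{2\alpha/(2\alpha+1)}\inf_{\hat s}\sup_{s\in\mathcal{P}(R,\alpha,p)}\mathbb{E}_s\|s-\hat s\|^2,$$ where the infimum is taken over all estimators $\hat s$.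
   Context: Model. $n=2^N$ with an integer $N\ge1$, and $r\ge2$ is an integer. $X_1,\dots,X_n$ are independent random column vectors, $X_i\in\{0,1\}^r$ with components summing to one. $X$ is the $r\times n$ random matrix with $i$th column $X_i$ and $s$ is its expectation (so each column of $s$ is a probability on $\{1,\dots,r\}$, and $s$ determines the law of $X$). $\mathbb{P}_s,\mathbb{E}_s$ denote probability and expectation when the mean of $X$ is $s$. An estimator is a function of $X$ with values in the $r\times n$ real matrices. For an $r\times n$ matrix $t$, $t^{(j)}$ is its $j$th line (a vector of $\mathbb{R}^n$), $t_i$ its $i$th column; $\langle t,t'\rangle=\sum_{i,j}t_i^{(j)}t_i'^{(j)}$ and $\|\cdot\|$ is the associated norm; $\langle\cdot,\cdot\rangle_q$ and $\|\cdot\|_q$ are the Euclidean inner product and norm of $\mathbb{R}^q$. For a linear subspace $S\subset\mathbb{R}^n$, $\mathbb{R}^r\otimes S$ is the set of $r\times n$ matrices all of whose lines belong to $S$. Haar basis. $\Lambda=\bigcup_{j=-1}^{N-1}\Lambda(j)$ where $\Lambda(-1)=\{(-1,0)\}$ and $\Lambda(j)=\{(j,k):k=0,\dots,2^j-1\}$ for $j\ge0$. Let $\varphi:\mathbb{R}\to\{-1,0,1\}$ equal $1$ on $(0,1/2]$, $-1$ on $(1/2,1]$ and $0$ elsewhere. For $\lambda\in\Lambda$, $\phi_\lambda\in\mathbb{R}^n$ has $i$th component $1/\sqrt n$ if $\lambda=(-1,0)$ and $\frac{2^{j/2}}{\sqrt n}\varphi\left(2^j\frac in-k\right)$ if $\lambda=(j,k)$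 with $j\ge0$. $\{\phi_\lambda,\lambda\in\Lambda\}$ is an orthonormal basis of $\mathbb{R}^n$. Class $\mathcal{P}(R,\alpha,p)$. For an $r\times n$ matrix $t$, let $\beta_\lambda\in\mathbb{R}^r$ have components $\beta_\lambda^{(j)}=\langle t^{(j)},\phi_\lambda\rangle_n$, $j=1,\dots,r$. For $R>0$, $p\in(0,2]$, $\alpha>1/p-1/2$, $\mathcal{P}(R,\alpha,p)$ is the set of $r\times n$ matrices $t$ whose columns are all probabilities on $\{1,\dots,r\}$ and such that $\sum_{j=0}^{N-1}2^{jp(\alpha+1/2-1/p)}\sum_{\lambda\in\Lambda(j)}\|\beta_\lambda\|_r^p\le n^{p/2}R^p$. Penalized estimator. Given a finite collection $\{S_m,m\in\mathcal{M}\}$ of linear subspaces of $\mathbb{R}^n$ with $D_m=\dim S_m$ and a penalty $\mathrm{pen}:\mathcal{M}\to\mathbb{R}_+$, $\hat s_m$ is the orthogonal projection of $X$ onto $\mathbb{R}^r\otimes S_m$, $\gamma_n(t)=\|t\|^2-2\langle X,t\rangle$, and $\tilde s=\hat s_{\hat m}$ where $\hat m$ minimizes $\gamma_n(\hat s_m)+\mathrm{pen}(m)$ over $m\in\mathcal{M}$. EH strategy. $\mathcal{M}$ is the collection of all subsets of $\Lambda$ that contain $(-1,0)$; $S_m$ is the linear span of $\{\phi_\lambda,\lambda\in m\}$, so $D_m=|m|$; and $\mathrm{pen}(m)=D_m\left(c_1\log\left(\frac{n}{D_m}\right)+c_2\right)$. *)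

(* Defs.v *)
From HB Require Import structures.
From mathcomp Require Import all_boot all_order all_algebra.
From mathcomp Require Import all_classical all_reals all_analysis.

Set Implicit Arguments.
Unset Strict Implicit.
Unset Printing Implicit Defensive.

Import Order.TTheory GRing.Theory Num.Theory.

Local Open Scope classical_set_scope.
Local Open Scope ring_scope.

(* The library norm `|t| of a real matrix is the sup norm, hence a separate
   Euclidean inner product and norm; the vectors of R^q are the 1 x q and
   q x 1 matrices. *)
Definition inner {R : realType} {a b : nat} (t u : 'M[R]_(a, b)) : R :=
  \sum_(i < a) \sum_(j < b) t i j * u i j.

Definition enorm {R : realType} {a b : nat} (t : 'M[R]_(a, b)) : R :=
  Num.sqrt (inner t t).

Definition prob_columns {R : realType} {r n : nat} (s : 'M[R]_(r, n)) : Prop :=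
  forall i : 'I_n, (forall j : 'I_r, 0 <= s j i) /\ \sum_(j < r) s j i = 1.

(* Independence of the columns. Each column takes finitely many values, so that
   the events below are measurable for arbitrary sets [B i]; the product rule
   for a subfamily of columns is the case [B i = setT] for the others. *)
Definition independent_columns d {Omega : measurableType d} {R : realType}
    {r n : nat} (P : probability Omega R) (X : Omega -> 'M[R]_(r, n)) : Prop :=
  forall B : 'I_n -> set 'cV[R]_r,
    P [set w | forall i, B i (col i (X w))] =
    (\prod_(i < n) P [set w | B i (col i (X w))])%E.

(* [P s] is the probability under which the mean of [X] is [s]; it is
   unconstrained when [s] is not the mean of such an [X]. *)
Definition categorical_model d {Omega : measurableType d} {R : realType}
    {r n : nat} (X : Omega -> 'M[R]_(r, n))
    (P : 'M[R]_(r, n) -> probability Omega R) : Prop :=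
  [/\ forall i j, measurable_fun setT (fun w => X w j i),
      forall w i, (forall j, X w j i = 0 \/ X w j i = 1) /\
                  \sum_(j < r) X w j i = 1
    & forall s, prob_columns s ->
        independent_columns (P s) X /\
        forall i j, ('E_(P s)[fun w => X w j i] = (s j i)%:E)%E].

Definition estimator (R : realType) (r n : nat) : Type :=
  'M[R]_(r, n) -> 'M[R]_(r, n).

Definition risk d {Omega : measurableType d} {R : realType} {r n : nat}
    (X : Omega -> 'M[R]_(r, n)) (P : 'M[R]_(r, n) -> probability Omega R)
    (shat : estimator R r n) (s : 'M[R]_(r, n)) : \bar R :=
  ('E_(P s)[fun w => (enorm (s - shat (X w)) ^+ 2)%R])%E.

Definition max_risk d {Omega : measurableType d} {R : realType} {r n : nat}
    (X : Omega -> 'M[R]_(r, n)) (P : 'M[R]_(r, n) -> probability Omega R)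
    (A : set 'M[R]_(r, n)) (shat : estimator R r n) : \bar R :=
  ereal_sup [set risk X P shat s | s in A].

Definition minimax_risk d {Omega : measurableType d} {R : realType} {r n : nat}
    (X : Omega -> 'M[R]_(r, n)) (P : 'M[R]_(r, n) -> probability Omega R)
    (A : set 'M[R]_(r, n)) : \bar R :=
  ereal_inf [set max_risk X P A shat | shat in [set: estimator R r n]].

(* [None] is the index (-1, 0) and [Some (Tagged _ k)], with [k : 'I_(2 ^ j)]
   and [j : 'I_N], is the index (j, k). *)
Definition haar_index (N : nat) : finType := option {j : 'I_N & 'I_(2 ^ j)}.

Definition haar_idx {N : nat} (j : 'I_N) (k : 'I_(2 ^ j)) : haar_index N :=
  Some (Tagged (fun j : 'I_N => 'I_(2 ^ j)) k).

Definition haar_mother {R : realType} (x : R) : R :=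
  if 0 < x <= 2^-1 then 1 else if 2^-1 < x <= 1 then -1 else 0.

(* Components are numbered from 1 in the mathematical formula, whence [i.+1]. *)
Definition haar {R : realType} {N : nat} (l : haar_index N) : 'rV[R]_(2 ^ N) :=
  \row_(i < 2 ^ N)
    match l with
    | None => (Num.sqrt (2 ^ N)%:R)^-1
    | Some u =>
        2 `^ ((tag u)%:R / 2) / Num.sqrt (2 ^ N)%:R *
        haar_mother (2 ^+ tag u * (i.+1%:R / (2 ^ N)%:R) - (tagged u)%:R)
    end.

Definition haar_coef {R : realType} {r N : nat} (t : 'M[R]_(r, 2 ^ N))
    (l : haar_index N) : 'cV[R]_r :=
  \col_(j < r) inner (row j t) (haar l).

(* The class P(L, alpha, p), with radius L. *)
Definition besov_class {R : realType} {r N : nat} (L alpha p : R) :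
    set 'M[R]_(r, 2 ^ N) :=
  [set t | prob_columns t /\
    \sum_(j < N) 2 `^ (j%:R * p * (alpha + 2^-1 - p^-1)) *
      \sum_(k < 2 ^ j) enorm (haar_coef t (haar_idx k)) `^ p
    <= (2 ^ N)%:R `^ (p / 2) * L `^ p].

(* The space of r x n matrices all of whose lines belong to S. *)
Definition tensor {R : realType} {r n : nat} (S : {vspace 'rV[R]_n}) :
    set 'M[R]_(r, n) :=
  [set t | forall j : 'I_r, row j t \in S].

Definition is_orth_proj {R : realType} {a b : nat} (V : set 'M[R]_(a, b))
    (x t : 'M[R]_(a, b)) : Prop :=
  V t /\ forall u, V u -> inner (x - t) u = 0.

(* [shat_m S] is, as a function of the observation x, the orthogonal projection
   of x onto [tensor S]; it exists and is unique, so the default value 0 of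
   [xget] is never used. *)
Definition shat_m {R : realType} {r n : nat} (S : {vspace 'rV[R]_n}) :
    estimator R r n :=
  fun x => xget 0 [set t | is_orth_proj (tensor S) x t].

Definition contrast {R : realType} {r n : nat} (x t : 'M[R]_(r, n)) : R :=
  enorm t ^+ 2 - 2 * inner x t.

(* [mhat x] is any minimizer over the collection: ties are broken
   arbitrarily. *)
Definition penalized_selector {R : realType} {r n : nat} {M : finType}
    (coll : {set M}) (S : M -> {vspace 'rV[R]_n}) (pen : M -> R)
    (mhat : 'M[R]_(r, n) -> M) : Prop :=
  forall x, mhat x \in coll /\
    forall m, m \in coll ->
      contrast x (shat_m (S (mhat x)) x) + pen (mhat x)
      <= contrast x (shat_m (S m) x) + pen m.

Definition penalized_estimator {R : realType} {r n : nat} {M : finType}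
    (S : M -> {vspace 'rV[R]_n}) (mhat : 'M[R]_(r, n) -> M) :
    estimator R r n :=
  fun x => shat_m (S (mhat x)) x.

Definition EH_collection (N : nat) : {set {set haar_index N}} :=
  [set m : {set haar_index N} | None \in m].

Definition EH_space (R : realType) {N : nat} (m : {set haar_index N}) :
    {vspace 'rV[R]_(2 ^ N)} :=
  <<[seq haar l | l <- enum m]>>%VS.

Definition EH_pen {R : realType} {N : nat} (c1 c2 : R)
    (m : {set haar_index N}) : R :=
  let D : R := (\dim (EH_space R m))%:R in
  D * (c1 * ln ((2 ^ N)%:R / D) + c2).

(* Main.v *)
Require Import Defs.
From HB Require Import structures.
From mathcomp Require Import all_boot all_order all_algebra.
From mathcomp Require Import all_classical all_reals all_analysis.
From mathcomp Require Import measurable_realfun.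
From mathcomp Require Import ring lra zify.

Set Implicit Arguments.
Unset Strict Implicit.
Unset Printing Implicit Defensive.

Import Order.TTheory GRing.Theory Num.Theory.
Import numFieldNormedType.Exports.

Local Open Scope classical_set_scope.
Local Open Scope ring_scope.

(** The observation takes finitely many values, and by independence each of
    them has the product of its column probabilities. Hence every risk is a
    finite sum ([expectation_mean]), and the argument only uses finite sums.

    Both sides are compared with
      W = Q^(1/(2 alpha + 1)) * ell^(2 alpha / (2 alpha + 1)),
    where Q = n L^2 and ell = 1 + ln (n^alpha / L). The selected estimator has
    risk at most a constant times W, whereas the minimax risk is at least a
    constant times Q^(1/(2 alpha + 1)).

    Upper bound. The Haar system is an orthonormal basis, so minimizing the
    penalized contrast amounts to choosing which coefficients to keep, and the
    loss splits coefficient by coefficient. The only random quantities are the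
    squared norms chi2(m) of the noise projected on the model m. Symmetrizing
    turns chi2(m) into a Rademacher chaos; integrating the signs out one at a
    time, with Gaussian-like control of the resulting quadratic forms, gives
      E exp (chi2(m) / 32) <= exp (|m| / 8)
    ([mean_expR_proj_form]). This bound does not depend on the number r of
    categories, because each column of the noise is a difference of two basis
    vectors after symmetrization. There are at most (e n / D)^D models of
    dimension D, so a penalty of order D (ln (n / D) + 1) dominates all the
    chi2(m) simultaneously ([mean_noise_excess]), which yields the oracle
    inequality [EH_oracle]. In the class P(L, alpha, p) one keeps all the
    coefficients below a level J and, above it, those exceeding a threshold that
    depends on the level. This leaves a squared bias of order Q 2^(-2 alpha J)
    with only O(2^J) coefficients ([besov_approx]); balancing with the penalty,
    that is 2^J of order (Q / ell)^(1/(2 alpha + 1)), gives W ([upper_level]).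

    Lower bound. Take the largest J with 2^(J (2 alpha + 1)) <= Q and perturb the
    uniform distribution on two categories by all sign combinations of the Haar
    functions of level J, with amplitude 1/4. These points belong to the class,
    and changing one sign keeps the two laws statistically close, so each of
    the 2^J signs costs a constant to any estimator ([minimax_lower]). *)

(** * The law of the observation as a finite sum *)

(** The possible observations, coded by finite functions so that expectations
    become finite sums. *)
Definition catmx {R : realType} {r n : nat} (f : {ffun 'I_n -> 'I_r}) :
    'M[R]_(r, n) :=
  \matrix_(j < r, i < n) (f i == j)%:R.

Definition mass {R : realType} {r n : nat} (s : 'M[R]_(r, n))
    (f : {ffun 'I_n -> 'I_r}) : R :=
  \prod_(i < n) s (f i) i.

Definition mean {R : realType} {r n : nat} (s : 'M[R]_(r, n))
    (g : {ffun 'I_n -> 'I_r} -> R) : R :=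
  \sum_f mass s f * g f.

Lemma catmx_surj (R : realType) (r n : nat) (x : 'M[R]_(r, n)) :
  (forall i : 'I_n, (forall j : 'I_r, x j i = 0 \/ x j i = 1) /\
     \sum_(j < r) x j i = 1) ->
  exists f, x = catmx f.
Proof.
move=> x01.
have ex1 i : exists j, x j i = 1.
  apply: contrapT => nex; have [xi sum1] := x01 i.
  suff : \sum_(j < r) x j i = 0 by rewrite sum1 => /eqP; rewrite oner_eq0.
  apply: big1 => j _; case: (xi j) => // xij.
  by exfalso; apply: nex; exists j.
have [h hx] := choice ex1.
exists [ffun i => h i]; apply/matrixP => j i; rewrite mxE ffunE.
have xf := hx i; have [xi sum1] := x01 i.
case: eqVneq => [<-//|nj].
move: sum1; rewrite (bigD1 (h i))//= xf => sum1.
have /eqP : \sum_(k < r | k != h i) x k i = 0.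
  by move: sum1 => /(congr1 (fun z => z - 1)); rewrite addrAC subrr add0r.
rewrite psumr_eq0; last by move=> k _; case: (xi k) => ->.
by move=> /allP/(_ j (mem_index_enum _)); rewrite eq_sym nj => /eqP.
Qed.

Lemma catmx_inj (R : realType) (r n : nat) :
  injective (@catmx R r n).
Proof.
move=> f g fg; apply/ffunP => i.
have := congr1 (fun x : 'M[R]_(r, n) => x (g i) i) fg; rewrite !mxE eqxx.
by case: eqVneq => // _ /eqP; rewrite eq_sym oner_eq0.
Qed.

Section Law.
Context d {Omega : measurableType d} {R : realType} {r n : nat}.
Variables (X : Omega -> 'M[R]_(r, n)) (P : 'M[R]_(r, n) -> probability Omega R).
Hypothesis XP : categorical_model X P.

Let X01 w i : (forall j : 'I_r, X w j i = 0 \/ X w j i = 1) /\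
  \sum_(j < r) X w j i = 1.
Proof. by have [_ + _] := XP; exact. Qed.

Let measX i j : measurable [set w | X w j i = 1].
Proof.
have [mX _ _] := XP.
by have := mX i j measurableT [set 1] (measurable_set1 _); rewrite setTI.
Qed.

Lemma entry_prob s (i : 'I_n) (j : 'I_r) : prob_columns s ->
  P s [set w | X w j i = 1] = (s j i)%:E.
Proof.
move=> ps; have [_ _ /(_ _ ps)[_ <-]] := XP.
have -> : (fun w => X w j i) = \1_[set w | X w j i = 1].
  apply/funext => w; rewrite indicE.
  have [xi _] := X01 w i.
  case: (xi j) => e; rewrite e; last by rewrite mem_set.
  by rewrite memNset//= e => /eqP; rewrite eq_sym oner_eq0.
by rewrite expectation_indic.
Qed.

Let eventE f : [set w | X w = catmx f] = [set w | forall i, X w (f i) i = 1].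
Proof.
apply/seteqP; split=> w /=; first by move=> -> i; rewrite mxE eqxx.
move=> xf; have [g eg] := catmx_surj (X01 w).
rewrite eg; congr catmx; apply/ffunP => i.
have := xf i; rewrite eg mxE.
by case: eqVneq => // _ /eqP; rewrite eq_sym oner_eq0.
Qed.

Lemma measurable_catmx f : measurable [set w | X w = catmx f].
Proof.
rewrite eventE.
rewrite [X in measurable X](_ : _ = \big[setI/setT]_(i < n) [set w | X w (f i) i = 1]).
  by apply: bigsetI_measurable => i _; exact: measX.
apply/seteqP; split=> w /=.
  by move=> h; elim/big_ind : _ => //= A B; split.
move=> h i; have := mem_index_enum i; move: h; elim: (index_enum _) => // a l IH.
rewrite big_cons => -[ha hl]; rewrite inE => /orP[/eqP ->//|]; exact: IH.
Qed.

Lemma prob_catmx s f : prob_columns s ->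
  P s [set w | X w = catmx f] = (mass s f)%:E.
Proof.
move=> ps; have [_ _ /(_ _ ps)[ind _]] := XP.
rewrite eventE /mass -prodEFin.
have := ind (fun i => [set c | c (f i) 0 = 1]).
have -> : [set w | forall i, [set c : 'cV_r | c (f i) 0 = 1] (col i (X w))] =
  [set w | forall i, X w (f i) i = 1].
  by apply/seteqP; split=> w /= h i; have := h i; rewrite mxE.
move=> ->; apply: eq_bigr => i _; rewrite -entry_prob//; congr (P s _).
by apply/seteqP; split=> w /=; rewrite mxE.
Qed.

(** The integrand is a linear combination of indicators of the events
    [X = catmx f], whose probabilities multiply over the columns. *)
Lemma expectation_mean s (g : 'M[R]_(r, n) -> R) :
  prob_columns s -> (forall x, 0 <= g x) ->
  ('E_(P s)[fun w => g (X w)] = (mean s (fun f => g (catmx f)))%:E)%E.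
Proof.
move=> ps g0; rewrite unlock /mean -sumEFin.
transitivity (\int[P s]_w \sum_(f : {ffun 'I_n -> 'I_r})
    ((g (catmx f))%:E * (\1_[set w | X w = catmx f] w)%:E))%E.
  apply: eq_integral => w _.
  have [f xf] := catmx_surj (X01 w).
  rewrite (bigD1 f)//= big1 ?adde0; last first.
    move=> h hf; rewrite indicE memNset ?mule0//= => /eqP.
    by rewrite xf (inj_eq (@catmx_inj _ _ _)) eq_sym (negbTE hf).
  by rewrite indicE mem_set ?mule1 -?xf.
have mI (f : {ffun 'I_n -> 'I_r}) : measurable_fun setT
    (fun w => (\1_[set w | X w = catmx f] w)%:E : \bar R).
  by apply/measurable_EFinP; exact: measurable_indic (measurable_catmx f).
rewrite ge0_integral_sum//; last 2 first.
- by move=> f; apply: measurable_funeM; exact: mI.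
- by move=> f w _; rewrite -EFinM lee_fin mulr_ge0.
apply: eq_bigr => f _.
rewrite ge0_integralZl// ?lee_fin// integral_indic// ?setIT;
  last exact: measurable_catmx.
have -> : (mass s f * g (catmx f))%:E = ((g (catmx f))%:E * (mass s f)%:E)%E.
  by rewrite -EFinM mulrC.
by congr (_ * _)%E; exact: prob_catmx.
Qed.
End Law.

(** * Exponential moments of Rademacher chaos *)

Section RademacherChaos.
Context {R : realType}.

(** The sharp constant is 1/2. The constant 2 only needs [1 + x <= expR x]: if
    [0 <= c < 1/2], bound [expR c] by [(1 - c)^-1] and [expR (- c)] by
    [(1 + c)^-1]; if [1/2 <= c], use [c <= 2 * c ^+ 2]. *)
Lemma cosh_le_expR (c : R) : (expR c + expR (- c)) / 2 <= expR (2 * c ^+ 2).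
Proof.
wlog c0 : c / 0 <= c.
  move=> h; have [|/ltW c0] := leP 0 c; first exact: h.
  by have := h (- c); rewrite oppr_ge0 opprK sqrrN addrC; apply.
have [c2|c2] := leP (2^-1) c.
  have : expR (- c) <= expR c by rewrite ler_expR; lra.
  have : expR c <= expR (2 * c ^+ 2) by rewrite ler_expR; nra.
  by lra.
have h1 : expR c <= (1 - c)^-1.
  have := expR_ge1Dx (- c); rewrite expRN => h.
  have p : 0 < 1 - c by lra.
  by rewrite -[expR c]invrK lef_pV2 ?posrE ?invr_gt0 ?expR_gt0.
have h2 : expR (- c) <= (1 + c)^-1.
  by rewrite expRN lef_pV2 ?posrE ?expR_gt0 ?expR_ge1Dx//; lra.
have h3 : ((1 - c)^-1 + (1 + c)^-1) / 2 <= 1 + 2 * c ^+ 2.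
  have -> : ((1 - c)^-1 + (1 + c)^-1) / 2 = (1 - c ^+ 2)^-1.
    by field; repeat (apply/andP; split); apply/eqP; nra.
  rewrite -div1r ler_pdivrMr; last by nra.
  have := sqr_ge0 c; have : c ^+ 2 <= 4^-1 by nra.
  by move: (c ^+ 2) => x; nra.
have := expR_ge1Dx (2 * c ^+ 2).
by lra.
Qed.

Variables (V : lmodType R) (I : eqType) (v : I -> V).

(** Expectation of [h] at [w] plus the sum of the [v i] with independent uniform
    signs. The recursion makes it possible to integrate one sign at a time. *)
Fixpoint sign_average (s : seq I) (h : V -> R) (w : V) : R :=
  if s is i :: s' then (sign_average s' h (w + v i) + sign_average s' h (w - v i)) / 2
  else h w.

Variable A : V -> V -> R.
Hypotheses (AC : forall x y, A x y = A y x)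
  (AD : forall x y z, A (x + y) z = A x z + A y z)
  (AZ : forall a x y, A (a *: x) y = a * A x y)
  (A_ge0 : forall x, 0 <= A x x).

(** Averaging [expR (B (w + v i) (w + v i))] over the sign of [v i] multiplies by
    a hyperbolic cosine, hence replaces the form [B] by [B] plus a rank-one
    term, up to the factor [expR (B (v i) (v i))]. *)
Fixpoint elim_form (s : seq I) (x y : V) : R :=
  if s is i :: s' then
    elim_form s' x y + 8 * elim_form s' x (v i) * elim_form s' (v i) y
  else A x y.

Lemma elim_formC s x y : elim_form s x y = elim_form s y x.
Proof.
elim: s x y => //= i s IH x y.
by rewrite IH [elim_form s x (v i)]IH [elim_form s (v i) y]IH -!mulrA [X in 8 * X]mulrC.
Qed.

Lemma elim_formDl s x y z :
  elim_form s (x + y) z = elim_form s x z + elim_form s y z.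
Proof. by elim: s x y z => //= i s IH x y z; rewrite !IH; ring. Qed.

Lemma elim_formZl s a x z : elim_form s (a *: x) z = a * elim_form s x z.
Proof. by elim: s x z => //= i s IH x z; rewrite !IH; ring. Qed.

Lemma elim_form_ge0 s x : 0 <= elim_form s x x.
Proof.
elim: s => //= i s IH; rewrite addr_ge0//.
by rewrite [elim_form s (v i) x]elim_formC -mulrA mulr_ge0// -expr2 sqr_ge0.
Qed.

Lemma elim_form_sq s a x y :
  elim_form s (x + a *: y) (x + a *: y) =
  elim_form s x x + 2 * a * elim_form s x y + a ^+ 2 * elim_form s y y.
Proof.
rewrite elim_formDl elim_formZl !(elim_formC s _ (_ + _)) !elim_formDl !elim_formZl.
by rewrite (elim_formC s y x); ring.
Qed.

(** The eliminated form is controlled as if the signs were Gaussian, where the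
    Laplace transform of a quadratic form is governed by such a supremum over
    the coefficients [a]. Each elimination step is paid by one coefficient. *)
Lemma elim_form_sup s x : uniq s -> exists a : I -> R,
  elim_form s x x <= A (x + \sum_(i <- s) a i *: v i) (x + \sum_(i <- s) a i *: v i)
                     - (\sum_(i <- s) a i ^+ 2) / 8.
Proof.
elim: s x => [x _|i s IH x /= /andP[si us]].
  by exists (fun=> 0); rewrite !big_nil mul0r subr0 addr0.
set b := elim_form s x (v i).
have [a ha] := IH (x + (8 * b) *: v i) us.
(* 8 * b maximizes 2 * b * t - t ^ 2 / 8 *)
exists (fun j => if j == i then 8 * b else a j).
rewrite !big_cons eqxx.
have neq j : j \in s -> (j == i) = false.
  by move=> js; apply/negP => /eqP ji; move: si; rewrite -ji js.
rewrite (eq_big_seq (fun j => a j *: v j)); last first.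
  by move=> j /neq ->.
rewrite [X in (_ + X) / 8](eq_big_seq (fun j => a j ^+ 2)); last first.
  by move=> j /neq ->.
rewrite addrA; apply: (@le_trans _ _ (elim_form s (x + (8 * b) *: v i)
  (x + (8 * b) *: v i) - (8 * b) ^+ 2 / 8)); last first.
  by move: ha; lra.
rewrite elim_form_sq -/b (elim_formC s (v i) x) -/b.
have := mulr_ge0 (sqr_ge0 (8 * b)) (elim_form_ge0 s (v i)).
by lra.
Qed.

Fixpoint elim_trace (s : seq I) : R :=
  if s is i :: s' then elim_form s' (v i) (v i) + elim_trace s' else 0.

Lemma sign_average_elim s w :
  sign_average s (fun x => expR (A x x)) w <= expR (elim_form s w w + elim_trace s).
Proof.
elim: s w => [w|i s IH w] /=; first by rewrite addr0.
set b := elim_form s w (v i).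
have hp := IH (w + v i); have hm := IH (w - v i).
have ep : elim_form s (w + v i) (w + v i) =
    elim_form s w w + elim_form s (v i) (v i) + 2 * b.
  by rewrite -{1 2}[v i]scale1r elim_form_sq -/b; ring.
have em : elim_form s (w - v i) (w - v i) =
    elim_form s w w + elim_form s (v i) (v i) - 2 * b.
  by rewrite -scaleN1r elim_form_sq -/b; ring.
move: hp hm; rewrite ep em => hp hm.
set E := elim_form s w w + elim_form s (v i) (v i) + elim_trace s.
have e1 : elim_form s w w + elim_form s (v i) (v i) + 2 * b + elim_trace s =
  E + 2 * b by rewrite /E; ring.
have e2 : elim_form s w w + elim_form s (v i) (v i) - 2 * b + elim_trace s =
  E + - (2 * b) by rewrite /E; ring.
rewrite e1 expRD in hp; rewrite e2 expRD in hm.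
rewrite (elim_formC s (v i) w) -/b.
have -> : elim_form s w w + 8 * b * b + (elim_form s (v i) (v i) + elim_trace s) =
  E + 2 * (2 * b) ^+ 2 by rewrite /E; ring.
rewrite expRD.
apply: le_trans (ler_wpM2l (expR_ge0 E) (cosh_le_expR (2 * b))).
by move: hp hm; lra.
Qed.

Lemma elim_trace_le s : uniq s ->
  (forall a : I -> R, 16 * A (\sum_(i <- s) a i *: v i) (\sum_(i <- s) a i *: v i)
     <= \sum_(i <- s) a i ^+ 2) ->
  elim_trace s <= 2 * \sum_(i <- s) A (v i) (v i).
Proof.
have AP x y : A (x + y) (x + y) <= 2 * A x x + 2 * A y y.
  have /= ep := elim_form_sq [::] 1 x y; have /= em := elim_form_sq [::] (-1) x y.
  have := A_ge0 (x + (-1) *: y); rewrite em; rewrite scale1r in ep; rewrite ep.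
  by lra.
elim: s => [_ _|i s IH /= /andP[si us] hs]; first by rewrite big_nil mulr0.
have neq j : j \in s -> (j == i) = false.
  by move=> js; apply/negP => /eqP ji; move: si; rewrite -ji js.
have hs' a : 16 * A (\sum_(j <- s) a j *: v j) (\sum_(j <- s) a j *: v j)
     <= \sum_(j <- s) a j ^+ 2.
  have := hs (fun j => if j == i then 0 else a j).
  rewrite !big_cons eqxx scale0r add0r expr0n/= add0r.
  rewrite (eq_big_seq (fun j => a j *: v j)); last by move=> j /neq ->.
  by rewrite [X in _ <= X -> _](eq_big_seq (fun j => a j ^+ 2)) // => j /neq ->.
rewrite big_cons mulrDr; apply: lerD; last exact: IH.
have [a ha] := elim_form_sup (v i) us.
apply: (le_trans ha); have := hs' a; have := AP (v i) (\sum_(j <- s) a j *: v j).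
by lra.
Qed.

(** Dimension-free bound for a Rademacher chaos of order two: under the spectral
    condition, the logarithm of the exponential moment is at most twice the
    trace. The condition is exactly what keeps every eliminated form below
    [2 * A] by [elim_form_sup]. *)
Lemma sign_average_expR s : uniq s ->
  (forall a : I -> R, 16 * A (\sum_(i <- s) a i *: v i) (\sum_(i <- s) a i *: v i)
     <= \sum_(i <- s) a i ^+ 2) ->
  sign_average s (fun x => expR (A x x)) 0 <= expR (2 * \sum_(i <- s) A (v i) (v i)).
Proof.
move=> us hs; apply: (le_trans (sign_average_elim s 0)); rewrite ler_expR.
have -> : elim_form s 0 0 = 0 by rewrite -(scale0r 0) elim_formZl mul0r.
by rewrite add0r elim_trace_le.
Qed.

End RademacherChaos.

(** * Symmetrization and concentration of quadratic forms of the noise *)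

Section Inner.
Context {R : realType} {a b : nat}.
Implicit Types x y z : 'M[R]_(a, b).

Lemma innerC x y : inner x y = inner y x.
Proof. by apply: eq_bigr => i _; apply: eq_bigr => j _; rewrite mulrC. Qed.

Lemma innerDl x y z : inner (x + y) z = inner x z + inner y z.
Proof.
rewrite -big_split; apply: eq_bigr => i _; rewrite -big_split.
by apply: eq_bigr => j _; rewrite mxE mulrDl.
Qed.

Lemma innerZl c x y : inner (c *: x) y = c * inner x y.
Proof.
rewrite mulr_sumr; apply: eq_bigr => i _; rewrite mulr_sumr.
by apply: eq_bigr => j _; rewrite mxE mulrA.
Qed.

Lemma innerDr x y z : inner z (x + y) = inner z x + inner z y.
Proof. by rewrite innerC innerDl !(innerC z). Qed.

Lemma innerZr c x y : inner y (c *: x) = c * inner y x.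
Proof. by rewrite innerC innerZl innerC. Qed.

Lemma innerNl x y : inner (- x) y = - inner x y.
Proof. by rewrite -scaleN1r innerZl mulN1r. Qed.

Lemma innerNr x y : inner y (- x) = - inner y x.
Proof. by rewrite innerC innerNl innerC. Qed.

Lemma innerBl x y z : inner (x - y) z = inner x z - inner y z.
Proof. by rewrite innerDl innerNl. Qed.

Lemma inner0l x : inner 0 x = 0.
Proof. by rewrite -(scale0r 0) innerZl mul0r. Qed.

Lemma inner_suml (I : Type) (s : seq I) (P : pred I) (F : I -> 'M[R]_(a, b)) z :
  inner (\sum_(i <- s | P i) F i) z = \sum_(i <- s | P i) inner (F i) z.
Proof.
elim: s => [|i s IH]; first by rewrite !big_nil inner0l.
by rewrite !big_cons; case: (P i); rewrite ?innerDl IH.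
Qed.

Lemma inner_ge0 x : 0 <= inner x x.
Proof. by apply: sumr_ge0 => i _; apply: sumr_ge0 => j _; rewrite -expr2 sqr_ge0. Qed.

Lemma inner_eq0 x : inner x x = 0 -> x = 0.
Proof.
move=> /eqP; rewrite psumr_eq0 => [/allP h|i _]; last first.
  by apply: sumr_ge0 => j _; rewrite -expr2 sqr_ge0.
apply/matrixP => i j; rewrite mxE.
have := h i (mem_index_enum _); rewrite psumr_eq0 => [/allP h2|k _]; last first.
  by rewrite -expr2 sqr_ge0.
by have := h2 j (mem_index_enum _); rewrite -expr2 sqrf_eq0 => /eqP.
Qed.

Lemma enorm_sq x : enorm x ^+ 2 = inner x x.
Proof. by rewrite /enorm sqr_sqrtr// inner_ge0. Qed.

End Inner.

Section Mean.
Context {R : realType} {r n : nat}.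
Variable s : 'M[R]_(r, n).
Implicit Types g h : {ffun 'I_n -> 'I_r} -> R.

Lemma eq_mean g h : g =1 h -> mean s g = mean s h.
Proof. by move=> gh; apply: eq_bigr => f _; rewrite gh. Qed.

Lemma meanD g h : mean s (fun f => g f + h f) = mean s g + mean s h.
Proof. by rewrite -big_split; apply: eq_bigr => f _; rewrite mulrDr. Qed.

Lemma meanZ c g : mean s (fun f => c * g f) = c * mean s g.
Proof. by rewrite mulr_sumr; apply: eq_bigr => f _; rewrite mulrCA. Qed.

Lemma mean_sum (I : Type) (l : seq I) (Q : pred I) (F : I -> {ffun 'I_n -> 'I_r} -> R) :
  mean s (fun f => \sum_(i <- l | Q i) F i f) = \sum_(i <- l | Q i) mean s (F i).
Proof. by rewrite exchange_big; apply: eq_bigr => f _; rewrite mulr_sumr. Qed.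

Hypothesis ps : prob_columns s.

Lemma mass_ge0 f : 0 <= mass s f.
Proof. by apply: prodr_ge0 => i _; have [+ _] := ps i; apply. Qed.

Lemma mass_sum1 : \sum_f mass s f = 1.
Proof.
rewrite /mass -(bigA_distr_bigA (fun i j => s j i)).
by apply: big1 => i _; have [_] := ps i.
Qed.

Lemma mean_cst c : mean s (fun=> c) = c.
Proof. by rewrite /mean -mulr_suml mass_sum1 mul1r. Qed.

Lemma ler_mean g h : (forall f, g f <= h f) -> mean s g <= mean s h.
Proof. by move=> gh; apply: ler_sum => f _; rewrite ler_wpM2l ?mass_ge0. Qed.

Lemma mean_catmx j i : mean s (fun f => (catmx f : 'M[R]_(r, n)) j i) = s j i.
Proof.
rewrite /mean /mass.
transitivity (\sum_(f : {ffun 'I_n -> 'I_r})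
   \prod_(k < n) (s (f k) k * (if k == i then (f k == j)%:R else 1))).
  apply: eq_bigr => f _; rewrite big_split/= -big_mkcond big_pred1_eq.
  by rewrite mxE.
rewrite -(bigA_distr_bigA (fun k l => s l k * (if k == i then (l == j)%:R else 1))).
rewrite (bigD1 i)//= [X in _ * X]big1 ?mulr1; last first.
  move=> k /negbTE ki; transitivity (\sum_(l < r) s l k); last by have [_] := ps k.
  by apply: eq_bigr => l _; rewrite ki mulr1.
rewrite eqxx (bigD1 j)//= eqxx mulr1 big1 ?addr0// => l /negbTE lj.
by rewrite lj mulr0.
Qed.

End Mean.

Section Symmetrization.
Context {R : realType} {r n : nat}.
Variable s : 'M[R]_(r, n).
Notation F := {ffun 'I_n -> 'I_r}.

Definition mean2 (H : F * F -> R) : R :=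
  \sum_p mass s p.1 * mass s p.2 * H p.

Lemma mean2E H : mean2 H = mean s (fun f => mean s (fun f' => H (f, f'))).
Proof.
rewrite /mean2 /mean.
under [RHS]eq_bigr do rewrite mulr_sumr.
by rewrite pair_big /=; apply: eq_bigr => -[f f'] _; rewrite /= mulrA.
Qed.

Definition swap_at (i : 'I_n) (p : F * F) : F * F :=
  ([ffun k => if k == i then p.2 k else p.1 k],
   [ffun k => if k == i then p.1 k else p.2 k]).

Lemma swap_atK i : involutive (swap_at i).
Proof.
move=> [f f']; rewrite /swap_at /=.
by congr (_, _); apply/ffunP => k; rewrite !ffunE /=; case: eqP.
Qed.

Lemma mean2_swap i H : mean2 (fun p => H (swap_at i p)) = mean2 H.
Proof.
rewrite /mean2 [RHS](reindex_inj (inv_inj (swap_atK i))) /=.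
apply: eq_bigr => -[f f'] _ /=; congr (_ * _).
rewrite /mass -!big_split/=; apply: eq_bigr => k _; rewrite !ffunE.
by case: ifP; rewrite // mulrC.
Qed.

(** Exchanging the two copies at coordinate [i] preserves their joint law and
    only reverses [v p i]; hence each term may be given a random sign. *)
Lemma mean2_sign_average (V : lmodType R) (h : V -> R) (v : F * F -> 'I_n -> V)
    (q : seq 'I_n) (w : F * F -> V) :
  uniq q ->
  (forall i p, i \in q -> w (swap_at i p) = w p) ->
  (forall i j p, v (swap_at i p) j = if j == i then - v p j else v p j) ->
  mean2 (fun p => h (w p + \sum_(i <- q) v p i)) =
  mean2 (fun p => sign_average (v p) q h (w p)).
Proof.
move=> + + vsw; elim: q w => [w _ _|i q IH w /= /andP[iq uq] wsw].
  by apply: eq_bigr => p _; rewrite big_nil addr0.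
have neq j : j \in q -> (i == j) = false.
  by move=> jq; apply/negP => /eqP ji; move: iq; rewrite ji jq.
have half (H : F * F -> R) : mean2 H = (mean2 H + mean2 (fun p => H (swap_at i p))) / 2.
  by rewrite mean2_swap; lra.
rewrite half.
have -> : mean2 (fun p => h (w p + \sum_(j <- (i :: q)) v p j)) =
    mean2 (fun p => sign_average (v p) q h (w p + v p i)).
  rewrite -IH//; last first.
    by move=> j p jq; rewrite wsw ?inE ?jq ?orbT// vsw neq.
  by apply: eq_bigr => p _; rewrite big_cons addrA.
have -> : mean2 (fun p => h (w (swap_at i p) + \sum_(j <- (i :: q)) v (swap_at i p) j)) =
    mean2 (fun p => sign_average (v p) q h (w p - v p i)).
  rewrite -IH//; last first.
    by move=> j p jq; rewrite wsw ?inE ?jq ?orbT// vsw neq.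
  apply: eq_bigr => p _; rewrite big_cons addrA wsw ?mem_head// vsw eqxx.
  congr (_ * h (_ + _)); apply: eq_big_seq => j jq.
  by rewrite vsw eq_sym neq.
rewrite /mean2 -big_split mulr_suml; apply: eq_bigr => p _ /=.
by rewrite -mulrDr mulrA.
Qed.
End Symmetrization.

Definition colpart {R : realType} {r n : nat} (x : 'M[R]_(r, n)) (i : 'I_n) : 'M[R]_(r, n) :=
  \matrix_(j < r, k < n) (if k == i then x j k else 0).

Section Concentration.
Context {R : realType} {r n : nat}.

Lemma sum_colpart (a : 'I_n -> R) (x : 'M[R]_(r, n)) :
  \sum_(i < n) a i *: colpart x i = \matrix_(j < r, k < n) (a k * x j k).
Proof.
apply/matrixP => j k; rewrite summxE !mxE (bigD1 k)//= !mxE eqxx.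
by rewrite big1 ?addr0// => i ik; rewrite !mxE eq_sym (negbTE ik) mulr0.
Qed.

Lemma sqr_catmxB_le (f f' : {ffun 'I_n -> 'I_r}) (i : 'I_n) :
  \sum_(j < r) ((catmx f - catmx f' : 'M[R]_(r, n)) j i) ^+ 2 <= 2.
Proof.
have s1 (k : 'I_r) : \sum_(j < r) ((k == j)%:R : R) = 1.
  rewrite (bigD1 k)//= eqxx big1 ?addr0// => j jk.
  by rewrite eq_sym (negbTE jk).
apply: (@le_trans _ _ (\sum_(j < r) ((f i == j)%:R + (f' i == j)%:R))).
  apply: ler_sum => j _; rewrite !mxE.
  by case: (f i == j); case: (f' i == j); rewrite /=; lra.
by rewrite big_split/= !s1.
Qed.

Lemma inner_colpart (x : 'M[R]_(r, n)) i :
  inner (colpart x i) (colpart x i) = \sum_(j < r) (x j i) ^+ 2.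
Proof.
apply: eq_bigr => j _; rewrite (bigD1 i)//= big1 ?addr0 => [|k ki].
  by rewrite !mxE eqxx.
by rewrite !mxE (negbTE ki) mul0r.
Qed.

Variable A : 'M[R]_(r, n) -> 'M[R]_(r, n) -> R.
Hypotheses (AC : forall x y, A x y = A y x)
  (AD : forall x y z, A (x + y) z = A x z + A y z)
  (AZ : forall a x y, A (a *: x) y = a * A x y)
  (A_ge0 : forall x, 0 <= A x x).
Variable dd : 'I_n -> R.
Hypotheses (A_le : forall x, 32 * A x x <= inner x x)
  (dd_ge0 : forall i, 0 <= dd i)
  (A_col : forall x i, A (colpart x i) (colpart x i) <=
     dd i * inner (colpart x i) (colpart x i)).

(** Conditionally on the two copies, the signed sum is a Rademacher chaos. Its
    vectors are supported by distinct columns and each of them has squared norm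
    at most 2, whence both the spectral condition and the trace bound. *)
Lemma mean2_expR (s : 'M[R]_(r, n)) : prob_columns s ->
  mean2 s (fun p => expR (A (catmx p.1 - catmx p.2) (catmx p.1 - catmx p.2)))
  <= expR (4 * \sum_(i < n) dd i).
Proof.
move=> ps.
pose W (p : {ffun 'I_n -> 'I_r} * {ffun 'I_n -> 'I_r}) : 'M[R]_(r, n) :=
  catmx p.1 - catmx p.2.
have sumW p : W p = 0 + \sum_(i <- enum 'I_n) colpart (W p) i.
  rewrite add0r big_enum /=.
  transitivity (\sum_(i < n) 1 *: colpart (W p) i); last first.
    by apply: eq_bigr => i _; rewrite scale1r.
  by rewrite (sum_colpart (fun=> 1)); apply/matrixP => j k; rewrite [RHS]mxE mul1r.
have -> : mean2 s (fun p => expR (A (catmx p.1 - catmx p.2) (catmx p.1 - catmx p.2))) =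
    mean2 s (fun p => expR (A (0 + \sum_(i <- enum 'I_n) colpart (W p) i)
       (0 + \sum_(i <- enum 'I_n) colpart (W p) i))).
  by apply: eq_bigr => p _; rewrite -sumW.
rewrite (@mean2_sign_average _ _ _ s _ (fun x => expR (A x x)) (fun p i => colpart (W p) i)
   (enum 'I_n) (fun=> 0)) ?enum_uniq//; last first.
  move=> i j p; case: eqVneq => [->|ji]; apply/matrixP => k l; rewrite !mxE.
    by case: eqVneq => [->|]; rewrite ?oppr0// !ffunE eqxx/= opprB.
  by case: eqVneq => [->|]; rewrite // !ffunE (negbTE ji).
rewrite mean2E -(mean_cst ps (expR _)); apply: ler_mean => // f.
rewrite -(mean_cst ps (expR _)); apply: ler_mean => // f'.
apply: (@le_trans _ _ (expR (2 * \sum_(i <- enum 'I_n)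
    A (colpart (W (f, f')) i) (colpart (W (f, f')) i)))).
  apply: sign_average_expR; rewrite ?enum_uniq// => a.
  rewrite !big_enum/= sum_colpart.
  set y := \matrix_(_, _) _.
  suff : inner y y <= 2 * \sum_(i < n) a i ^+ 2 by have := A_le y; lra.
  rewrite /inner exchange_big mulr_sumr; apply: ler_sum => i _.
  have -> : \sum_(j < r) y j i * y j i =
      a i ^+ 2 * \sum_(j < r) (W (f, f') j i) ^+ 2.
    by rewrite mulr_sumr; apply: eq_bigr => j _; rewrite !mxE; ring.
  by rewrite [leRHS]mulrC; apply: ler_wpM2l; [exact: sqr_ge0|exact: sqr_catmxB_le].
rewrite ler_expR big_enum/= -[leRHS]/(4 * _) (_ : 4 = 2 * 2); last by lra.
rewrite -mulrA ler_wpM2l// mulr_sumr; apply: ler_sum => i _.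
apply: (le_trans (A_col _ _)); rewrite mulrC ler_wpM2r//.
by rewrite inner_colpart sqr_catmxB_le.
Qed.

(** By Jensen's inequality, replacing the mean [s] by an independent copy of the
    observation increases the exponential moment. *)
Lemma mean_expR_form (s : 'M[R]_(r, n)) : prob_columns s ->
  mean s (fun f => expR (A (catmx f - s) (catmx f - s)))
  <= expR (4 * \sum_(i < n) dd i).
Proof.
move=> ps; apply: le_trans (mean2_expR ps).
have sqA y z : A (y + z) (y + z) = A y y + 2 * A z y + A z z.
  by rewrite AD (AC y (y + z)) (AC z (y + z)) !AD (AC y z); ring.
rewrite mean2E; apply: ler_mean => // f /=.
set x := catmx f - s; set q0 := A x x.
(* tangent of the exponential at q0, whose slope term has mean zero *)
have lin f' : expR q0 * (1 + 2 * A (s - catmx f') x) <=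
    expR (A (catmx f - catmx f') (catmx f - catmx f')).
  set q := A (catmx f - _) _.
  have qe : q = q0 + 2 * A (s - catmx f') x + A (s - catmx f') (s - catmx f').
    rewrite /q /q0 (_ : catmx f - catmx f' = x + (s - catmx f')); last first.
      by rewrite /x addrA subrK.
    exact: sqA.
  have -> : q = q0 + (q - q0) by rewrite addrC subrK.
  rewrite expRD ler_wpM2l ?expR_ge0//; apply: le_trans (expR_ge1Dx _).
  by have := A_ge0 (s - catmx f'); rewrite qe; lra.
have AN y z : A (- y) z = - A y z by rewrite -scaleN1r AZ mulN1r.
have A0 z : A 0 z = 0 by rewrite -(scale0r 0) AZ mul0r.
have Asum (I : Type) (l : seq I) (G : I -> 'M[R]_(r, n)) z :
    A (\sum_(i <- l) G i) z = \sum_(i <- l) A (G i) z.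
  by elim: l => [|i l IH]; rewrite ?big_nil ?A0// !big_cons AD IH.
have m0 : mean s (fun f' => A (s - catmx f') x) = 0.
  have sE : s = \sum_f' mass s f' *: (catmx f' : 'M[R]_(r, n)).
    apply/matrixP => j i; rewrite summxE -(mean_catmx ps).
    by apply: eq_bigr => f' _; rewrite !mxE.
  have -> : mean s (fun f' => A (s - catmx f') x) =
     mean s (fun f' => A s x + (-1) * A (catmx f') x).
    by apply: eq_mean => f'; rewrite AD AN mulN1r.
  rewrite meanD meanZ mean_cst// [X in A X _]sE Asum.
  rewrite /mean; under eq_bigr do rewrite AZ.
  by rewrite mulN1r subrr.
have <- : mean s (fun f' => expR q0 * (1 + 2 * A (s - catmx f') x)) = expR q0.
  by rewrite meanZ meanD mean_cst// meanZ m0 mulr0 addr0 mulr1.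
exact: ler_mean.
Qed.

End Concentration.

(** * The Haar system is orthonormal and complete *)

(** Reflecting the position [i] in the two halves of the dyadic block of length
    [2 ^ b.+1] that contains it. This reverses the Haar function changing sign
    at that scale and leaves all coarser ones unchanged. *)
Definition flip_bit (b i : nat) : nat :=
  if odd (i %/ 2 ^ b) then (i - 2 ^ b)%N else (i + 2 ^ b)%N.

Lemma flip_bit_div b i : (flip_bit b i %/ 2 ^ b)%N =
  if odd (i %/ 2 ^ b) then (i %/ 2 ^ b).-1 else (i %/ 2 ^ b).+1.
Proof.
rewrite /flip_bit; have p : (0 < 2 ^ b)%N by rewrite expn_gt0.
case: ifP => o; last by rewrite divnDr ?dvdnn// divnn p addn1.
by rewrite -{1}[(2 ^ b)%N]mul1n divnBMl subn1.
Qed.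

Lemma flip_bit_div_gt b c i : (b < c)%N ->
  (flip_bit b i %/ 2 ^ c)%N = (i %/ 2 ^ c)%N.
Proof.
move=> bc; have -> : (2 ^ c = 2 ^ b * (2 * 2 ^ (c - b.+1)))%N.
  by rewrite -expnS -expnD; congr (2 ^ _)%N; lia.
rewrite !divnMA flip_bit_div; congr (_ %/ _)%N.
rewrite !divn2; move: (i %/ 2 ^ b)%N => q; case: ifP => o.
  by case: q o => //= q /negbTE o; rewrite uphalf_half o.
by rewrite /= uphalf_half o.
Qed.

Lemma flip_bit_lt b N i : (b < N)%N -> (i < 2 ^ N)%N -> (flip_bit b i < 2 ^ N)%N.
Proof.
move=> bN iN; have := flip_bit_div_gt i bN; rewrite (divn_small iN) => /eqP.
by rewrite eqn0Ngt divn_gt0 ?expn_gt0// -ltnNge.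
Qed.

Lemma flip_bitK b : involutive (flip_bit b).
Proof.
move=> i; rewrite {1}/flip_bit flip_bit_div.
have p : (0 < 2 ^ b)%N by rewrite expn_gt0.
rewrite /flip_bit; case o: (odd (i %/ 2 ^ b)); last by rewrite /= o addnK.
have q0 : (0 < i %/ 2 ^ b)%N by case: (i %/ 2 ^ b)%N o.
rewrite (_ : odd _.-1 = false); last by move: q0 o; case: (i %/ 2 ^ b)%N => //= m _ /negbTE.
by rewrite subnK// -(divn_gt0 _ p).
Qed.

Section HaarFormula.
Context {R : realType} {N : nat}.

Definition haar_scale (j : nat) : R := 2 `^ (j%:R / 2) / Num.sqrt (2 ^ N)%:R.

Lemma haar_scale_sq j : haar_scale j ^+ 2 = 2 ^+ j / 2 ^+ N.
Proof.
rewrite /haar_scale expr_div_n sqr_sqrtr ?ler0n// natrX; congr (_ / _).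
by rewrite -powR_mulrn ?powR_ge0// -powRrM divfK ?powR_mulrn// pnatr_eq0.
Qed.

(** [h] is half the length of the support: the block number of [i] at scale
    [2 * h] locates the support, and the parity of its block number at scale
    [h] gives the sign. *)
Lemma haar_motherE (h i k : nat) : (0 < h)%N ->
  haar_mother (i.+1%:R / (2 * h)%:R - k%:R : R) =
  ((i %/ h)./2 == k)%:R * (-1) ^+ (i %/ h).
Proof.
move=> h0; have hp : 0 < (2 * h)%:R :> R by rewrite ltr0n muln_gt0.
have xE : i.+1%:R / (2 * h)%:R - k%:R = (i.+1%:R - (2 * h * k)%:R) / (2 * h)%:R :> R.
  by rewrite [(2 * h * k)%N]mulnC [(k * _)%:R]natrM mulrBl mulfK// gt_eqF.
have c1 : (0 < (i.+1%:R - (2 * h * k)%:R) / (2 * h)%:R :> R) = (2 * h * k < i.+1)%N.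
  by rewrite pmulr_lgt0 ?invr_gt0// subr_gt0 ltr_nat.
have c2 : ((i.+1%:R - (2 * h * k)%:R) / (2 * h)%:R <= 2^-1 :> R) =
    (i.+1 <= h + 2 * h * k)%N.
  rewrite ler_pdivrMr// [(2 * h)%:R]natrM mulrA mulVf ?mul1r ?pnatr_eq0// lerBlDr.
  by rewrite -natrD ler_nat.
have c3 : ((i.+1%:R - (2 * h * k)%:R) / (2 * h)%:R <= 1 :> R) =
    (i.+1 <= 2 * h + 2 * h * k)%N.
  by rewrite ler_pdivrMr// mul1r lerBlDr -natrD ler_nat.
rewrite /haar_mother xE [2^-1 < _]ltNge c1 c2 c3.
have e1 : (2 * h * k < i.+1 <= h + 2 * h * k)%N = (i %/ h == 2 * k)%N.
  rewrite eqn_leq -[(i %/ h <= _)%N]ltnS ltn_divLR// leq_divRL// andbC.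
  by congr (_ && _); lia.
have e2 : ((h + 2 * h * k < i.+1) && (i.+1 <= 2 * h + 2 * h * k))%N =
    (i %/ h == (2 * k).+1)%N.
  rewrite eqn_leq -[(i %/ h <= _)%N]ltnS ltn_divLR// leq_divRL// andbC.
  by congr (_ && _); lia.
rewrite -ltnNge e1 e2; move: (i %/ h)%N => q.
case: eqVneq => [->|n1].
  by rewrite mul2n doubleK eqxx mul1r -signr_odd odd_double.
case: eqVneq => [->|n2].
  by rewrite mul2n /= uphalf_double eqxx mul1r exprS -signr_odd odd_double mulr1.
by rewrite (_ : (q./2 == k) = false) ?mul0r//; lia.
Qed.

Lemma haarE (j : 'I_N) (k : 'I_(2 ^ j)) (i : 'I_(2 ^ N)) :
  haar (haar_idx k) 0 i = haar_scale j *
   (((i %/ 2 ^ (N - j.+1))./2 == k)%N%:R * (-1) ^+ (i %/ 2 ^ (N - j.+1))) :> R.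
Proof.
rewrite mxE /=; congr (_ * _); rewrite -haar_motherE ?expn_gt0//.
congr (haar_mother (_ - _)).
have -> : (2 ^ N)%:R = 2 ^+ j * (2 * 2 ^ (N - j.+1))%:R :> R.
  rewrite -natrX -natrM; congr _%:R; rewrite -expnS -expnD; congr (2 ^ _)%N.
  by have := ltn_ord j; lia.
rewrite invfM mulrCA !mulrA mulfK// mulrC mulKf//.
Qed.

Lemma haar_None (i : 'I_(2 ^ N)) : haar None 0 i = (Num.sqrt (2 ^ N)%:R)^-1 :> R.
Proof. by rewrite mxE. Qed.

Lemma inner_rowE (x y : 'rV[R]_(2 ^ N)) : inner x y = \sum_i x 0 i * y 0 i.
Proof. by rewrite /inner big_ord1. Qed.

(** A vector constant on the blocks on which a Haar function oscillates is
    orthogonal to it, since flipping the corresponding bit changes the sign of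
    the inner product. *)
Lemma inner_flip (j : 'I_N) (k : 'I_(2 ^ j)) (x : 'rV[R]_(2 ^ N)) :
  (forall i i' : 'I_(2 ^ N), i' = flip_bit (N - j.+1) i :> nat -> x 0 i' = x 0 i) ->
  inner x (haar (haar_idx k)) = 0.
Proof.
move=> xf; rewrite inner_rowE.
have bN : (N - j.+1 < N)%N by have := ltn_ord j; lia.
pose fl (i : 'I_(2 ^ N)) := Ordinal (flip_bit_lt bN (ltn_ord i)).
have flK : involutive fl by move=> i; apply: val_inj; rewrite /= flip_bitK.
set S := \sum_i _.
suff : S = - S by lra.
rewrite {1}/S (reindex_inj (inv_inj flK)) /= -sumrN; apply: eq_bigr => i _.
rewrite (xf i)// !haarE /= flip_bit_div -!mulrN; congr (_ * (_ * _)).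
move: (i %/ _)%N => q; case: ifP => o.
  case: q o => //= q o; rewrite exprS mulN1r opprK; congr ((_ == _)%:R * _).
  by rewrite uphalf_half (negbTE o).
by rewrite exprS mulN1r /= uphalf_half o.
Qed.

Lemma count_block (j : 'I_N) (k : 'I_(2 ^ j)) :
  \sum_(i < 2 ^ N) (((i %/ 2 ^ (N - j.+1))./2 == k)%N%:R : R) = 2 ^+ N / 2 ^+ j.
Proof.
have e : (2 ^ N = 2 ^ j * 2 ^ (N - j))%N.
  by rewrite -expnD; congr (2 ^ _)%N; have := ltn_ord j; lia.
have e2 : (2 ^ (N - j) = 2 ^ (N - j.+1) * 2)%N.
  by rewrite -expnSr; congr (2 ^ _)%N; have := ltn_ord j; lia.
under eq_bigr do rewrite -divn2 -divnMA -e2.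
rewrite -(big_mkord xpredT (fun i => ((i %/ 2 ^ (N - j) == k)%N%:R : R))) e.
rewrite big_nat_mul.
have -> : \sum_(0 <= i < 2 ^ j) \sum_(i * 2 ^ (N - j) <= a < i.+1 * 2 ^ (N - j))
    (((a %/ 2 ^ (N - j))%N == k)%:R : R) =
    \sum_(0 <= i < 2 ^ j) (i == k :> nat)%:R * (2 ^ (N - j))%:R.
  apply: eq_bigr => i _; rewrite -{1}[(i * _)%N]add0n big_addn.
  rewrite -mulnBl subSnn mul1n mulr_natr -[in RHS](subn0 (2 ^ (N - j))%N).
  rewrite -sumr_const_nat; apply: eq_big_nat => a /andP[_ al].
  by rewrite addnC divnMDl ?expn_gt0// divn_small ?addn0.
rewrite big_mkord (bigD1 k)//= eqxx mul1r big1 ?addr0; last first.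
  by move=> i /negbTE; rewrite -val_eqE /= => ->; rewrite mul0r.
have -> : (2 : R) ^+ N = 2 ^+ j * (2 ^ (N - j))%:R by rewrite -natrX e natrM natrX.
by rewrite mulrAC divff ?mul1r// expf_neq0// pnatr_eq0.
Qed.

Lemma haar_orthonormal (l l' : haar_index N) :
  inner (haar l) (haar l') = (l == l')%:R :> R.
Proof.
have n0 : (2 ^ N)%:R != 0 :> R by rewrite pnatr_eq0 expn_eq0.
case: l l' => [[j k]|] [[j' k']|].
- rewrite -![Some _]/(haar_idx _).
  have [jj|jj|jj] := ltngtP j j'.
  + rewrite inner_flip => [|i i' ii].
      by case: eqP => // -[ej _]; exfalso; move: jj; rewrite ej ltnn.
    rewrite !haarE ii flip_bit_div_gt//; have := ltn_ord j'; lia.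
  + rewrite innerC inner_flip => [|i i' ii].
      by case: eqP => // -[ej _]; exfalso; move: jj; rewrite ej ltnn.
    rewrite !haarE ii flip_bit_div_gt//; have := ltn_ord j; lia.
  + have ej := val_inj jj; case: _ / ej k' => k' {jj j'}.
    have -> : (haar_idx k == haar_idx k') = (k == k').
      apply/eqP/eqP => [kk|->//].
      apply: (@eq_from_Tagged _ (fun j : 'I_N => 'I_(2 ^ j) : Type) j).
      by move: kk; rewrite /haar_idx; apply: Some_inj.
    rewrite inner_rowE.
    transitivity (\sum_(i < 2 ^ N) haar_scale j ^+ 2 * (k == k')%:R *
      (((i %/ 2 ^ (N - j.+1))./2 == k)%N%:R : R)).
      apply: eq_bigr => i _; rewrite !haarE.
      have sq : ((-1) ^+ (i %/ 2 ^ (N - j.+1))) * ((-1) ^+ (i %/ 2 ^ (N - j.+1))) = 1 :> R.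
        by rewrite -expr2 sqrr_sign.
      have [->|kk] := eqVneq k k'.
        case: (_ == _); rewrite ?mul0r ?mulr0 ?mulr1 ?mul0r//.
        by rewrite !mul1r mulrACA sq mulr1 expr2.
      have [e1|] := eqVneq ((i %/ 2 ^ (N - j.+1))./2) (k : nat); rewrite ?mul0r ?mulr0 ?mul0r//.
      by rewrite e1 (negbTE (_ : (k : nat) != k')) ?mul0r ?mulr0 ?mul0r//.
    have p2 a : 2 ^+ a != 0 :> R by rewrite expf_neq0// pnatr_eq0.
    rewrite -mulr_sumr count_block haar_scale_sq.
    by rewrite mulrAC mulrA mulfVK// divff// mul1r.
- rewrite innerC inner_flip// => i i' _; by rewrite !haar_None.
- rewrite inner_flip// => i i' _; by rewrite !haar_None.
- rewrite inner_rowE; under eq_bigr do rewrite !haar_None -invfM -expr2 sqr_sqrtr ?ler0n//.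
  by rewrite sumr_const card_ord -[_ *+ _]mulr_natr mulVf.
Qed.

Lemma card_haar_index : #|haar_index N| = (2 ^ N)%N.
Proof.
rewrite card_option card_tagged sumnE big_map big_enum /=.
under eq_bigr do rewrite card_ord.
elim: N => [|n IH]; first by rewrite big_ord0.
by rewrite big_ord_recr /= -addSn IH expnS mul2n addnn.
Qed.

(** The Haar system has as many elements as the dimension, so its matrix is
    square: orthonormality of the rows implies that of the columns. *)
Lemma haar_complete (i k : 'I_(2 ^ N)) :
  \sum_l haar l 0 i * haar l 0 k = (i == k)%:R :> R.
Proof.
pose e (a : 'I_(2 ^ N)) := enum_val (cast_ord (esym card_haar_index) a).
have be : bijective e.
  apply: bij_comp (enum_val_bij _) _.
  exists (cast_ord card_haar_index) => a; [exact: cast_ordKV|exact: cast_ordK].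
pose H : 'M[R]_(2 ^ N) := \matrix_(a, b) haar (e a) 0 b.
have HH : H *m H^T = 1%:M.
  apply/matrixP => a b; rewrite !mxE -(inj_eq (bij_inj be)) -haar_orthonormal.
  by rewrite inner_rowE; apply: eq_bigr => c _; rewrite !mxE.
have := congr1 (fun M : 'M[R]_(2 ^ N) => M i k) (mulmx1C HH); rewrite !mxE => <-.
rewrite (reindex e) /=; last exact: onW_bij.
by apply: eq_bigr => a _; rewrite !mxE.
Qed.

End HaarFormula.

(** * Haar coefficients and projection estimators *)

Section HaarCoefficients.
Context {R : realType} {r N : nat}.
Implicit Types (x y t : 'M[R]_(r, 2 ^ N)) (m : {set haar_index N}).

Lemma haar_coefE t l j : haar_coef t l j 0 = \sum_i t j i * haar l 0 i.
Proof. by rewrite mxE inner_rowE; apply: eq_bigr => i _; rewrite mxE. Qed.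

Lemma haar_coefD x y l : haar_coef (x + y) l = haar_coef x l + haar_coef y l.
Proof. by apply/colP => j; rewrite !mxE -innerDl linearD. Qed.

Lemma haar_coefZ a x l : haar_coef (a *: x) l = a *: haar_coef x l.
Proof. by apply/colP => j; rewrite !mxE -innerZl linearZ. Qed.

Lemma haar_coefB x y l : haar_coef (x - y) l = haar_coef x l - haar_coef y l.
Proof. by rewrite -scaleN1r haar_coefD haar_coefZ scaleN1r. Qed.

Lemma inner_colE (u v : 'cV[R]_r) : inner u v = \sum_j u j 0 * v j 0.
Proof. by apply: eq_bigr => j _; rewrite big_ord1. Qed.

(** Inner product of the projections of [x] and [y] on the model [m], in
    coordinates. *)
Definition proj_form m x y : R :=
  \sum_(l in m) inner (haar_coef x l) (haar_coef y l).

Lemma parseval x y :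
  \sum_l inner (haar_coef x l) (haar_coef y l) = inner x y.
Proof.
under eq_bigr do rewrite inner_colE.
rewrite exchange_big; apply: eq_bigr => j _ /=.
transitivity (\sum_l \sum_i \sum_k (x j i * y j k) * (haar l 0 i * haar l 0 k)).
  apply: eq_bigr => l _; rewrite !haar_coefE mulr_suml; apply: eq_bigr => i _.
  by rewrite mulr_sumr; apply: eq_bigr => k _; rewrite mulrACA.
rewrite exchange_big; apply: eq_bigr => i _ /=.
rewrite exchange_big/= (bigD1 i)//= -mulr_sumr haar_complete eqxx mulr1.
rewrite big1 ?addr0// => k ki; rewrite -mulr_sumr haar_complete eq_sym.
by rewrite (negbTE ki) mulr0.
Qed.

Lemma proj_formC m x y : proj_form m x y = proj_form m y x.
Proof. by apply: eq_bigr => l _; rewrite innerC. Qed.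

Lemma proj_formDl m x y z : proj_form m (x + y) z = proj_form m x z + proj_form m y z.
Proof. by rewrite -big_split; apply: eq_bigr => l _; rewrite haar_coefD innerDl. Qed.

Lemma proj_formZl m a x y : proj_form m (a *: x) y = a * proj_form m x y.
Proof. by rewrite mulr_sumr; apply: eq_bigr => l _; rewrite haar_coefZ innerZl. Qed.

Lemma proj_form_ge0 m x : 0 <= proj_form m x x.
Proof. by apply: sumr_ge0 => l _; exact: inner_ge0. Qed.

Lemma proj_form_le m x : proj_form m x x <= inner x x.
Proof.
rewrite -parseval [leRHS](bigID [in m])/= lerDl.
by apply: sumr_ge0 => l _; exact: inner_ge0.
Qed.

Definition hproj m x : 'M[R]_(r, 2 ^ N) := \sum_(l in m) haar_coef x l *m haar l.

Lemma haar_coef_sum (I : Type) (s : seq I) (P : pred I) (F : I -> 'M[R]_(r, 2 ^ N)) l :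
  haar_coef (\sum_(i <- s | P i) F i) l = \sum_(i <- s | P i) haar_coef (F i) l.
Proof.
elim: s => [|i s IH]; last by rewrite !big_cons; case: (P i); rewrite ?haar_coefD IH.
by rewrite !big_nil -(scale0r 0) haar_coefZ scale0r.
Qed.

Lemma haar_coef_mul (u : 'cV[R]_r) (l l' : haar_index N) :
  haar_coef (u *m haar l) l' = (l == l')%:R *: u.
Proof.
apply/colP => j; rewrite haar_coefE !mxE -haar_orthonormal inner_rowE mulr_suml.
by apply: eq_bigr => i _; rewrite mxE big_ord1 -mulrA mulrC.
Qed.

Lemma haar_coef_proj m x l :
  haar_coef (hproj m x) l = if l \in m then haar_coef x l else 0.
Proof.
rewrite haar_coef_sum; under eq_bigr do rewrite haar_coef_mul.
case: ifP => lm.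
  rewrite (bigD1 l)//= eqxx scale1r big1 ?addr0// => l' /andP[_ /negbTE ->].
  by rewrite scale0r.
apply: big1 => l' l'm; case: eqVneq => [e|]; rewrite ?scale0r//.
by rewrite e lm in l'm.
Qed.

Lemma hproj_span m x j : row j (hproj m x) \in EH_space R m.
Proof.
rewrite /hproj raddf_sum /=; apply: memv_suml => l lm.
have -> : row j (haar_coef x l *m haar l) = haar_coef x l j 0 *: haar l.
  by apply/rowP => i; rewrite !mxE big_ord1 !mxE.
by rewrite memvZ// memv_span//; apply: map_f; rewrite mem_enum.
Qed.

Lemma span_haar_orth m (u : 'rV[R]_(2 ^ N)) l :
  u \in EH_space R m -> l \notin m -> inner u (haar l) = 0.
Proof.
move=> /coord_span -> lm; rewrite inner_suml big1// => i _.
rewrite innerZl.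
have -> : (map_tuple [eta haar] (enum_tuple m))`_i =
    haar (nth None (enum m) i) :> 'rV[R]_(2 ^ N).
  by rewrite /= (nth_map None)// -cardE.
rewrite haar_orthonormal; case: eqVneq => [e|]; rewrite ?mulr0//.
have : nth None (enum m) i \in enum m by apply: mem_nth; rewrite -cardE.
by rewrite mem_enum e (negbTE lm).
Qed.

Lemma shat_mE m x : shat_m (EH_space R m) x = hproj m x.
Proof.
have tproj t : tensor (EH_space R m) t -> forall l, l \notin m -> haar_coef t l = 0.
  by move=> tt l lm; apply/colP => j; rewrite !mxE (span_haar_orth (tt j)).
have isp : is_orth_proj (tensor (EH_space R m)) x (hproj m x).
  split; first by move=> j; exact: hproj_span.
  move=> u tu; rewrite -parseval big1// => l _.
  rewrite haar_coefB haar_coef_proj; case: ifP => lm; first by rewrite subrr inner0l.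
  by rewrite innerC (tproj u tu l) ?lm// inner0l.
rewrite /shat_m; case: xgetP => [t _ [tt ot]|no]; last by case: (no (hproj m x)).
apply/eqP; rewrite -subr_eq0; apply/eqP; apply: inner_eq0.
have td : tensor (EH_space R m) (t - hproj m x).
  move=> j; rewrite linearB /=; apply: memvB; [exact: tt|exact: hproj_span].
have e y : t - y = (x - y) - (x - t) by apply/matrixP => a b; rewrite !mxE; ring.
by rewrite {1}e innerBl (ot _ td) (isp.2 _ td) subrr.
Qed.

Lemma dim_EH_space m : \dim (EH_space R m) = #|m|.
Proof.
pose X : seq 'rV[R]_(2 ^ N) := [seq haar l | l <- enum m].
have nthX a : (a < #|m|)%N -> X`_a = haar (nth None (enum m) a).
  by move=> am; rewrite (nth_map None)// -cardE.
have sz : size X = #|m| by rewrite size_map -cardE.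
suff : free X by rewrite /free sz => /eqP.
apply/(@freeP _ _ _ (in_tuple X)) => k k0 i.
have im (a : 'I_(size X)) : (a < #|m|)%N by rewrite -sz.
have := congr1 (fun u => inner u (haar (nth None (enum m) i))) k0.
rewrite inner0l inner_suml (bigD1 i)//= innerZl nthX// haar_orthonormal eqxx mulr1.
rewrite big1 ?addr0// => b bi; rewrite innerZl nthX// haar_orthonormal.
by rewrite nth_uniq ?enum_uniq -?cardE// (negbTE (_ : b != i :> nat)) ?mulr0.
Qed.

(** Pythagoras: the penalized criterion trades the energy of the coefficients
    kept against the penalty. *)
Lemma contrast_shat m x : contrast x (shat_m (EH_space R m) x) = - proj_form m x x.
Proof.
rewrite shat_mE /contrast enorm_sq -!parseval.
have -> : \sum_l inner (haar_coef (hproj m x) l) (haar_coef (hproj m x) l) =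
    proj_form m x x.
  rewrite /proj_form [RHS]big_mkcond; apply: eq_bigr => l _.
  by rewrite haar_coef_proj; case: ifP => _; rewrite // inner0l.
have -> : \sum_l inner (haar_coef x l) (haar_coef (hproj m x) l) = proj_form m x x.
  rewrite /proj_form [RHS]big_mkcond; apply: eq_bigr => l _.
  by rewrite haar_coef_proj; case: ifP => _; rewrite // innerC inner0l.
by lra.
Qed.

Lemma loss_shat m x s : enorm (s - shat_m (EH_space R m) x) ^+ 2 =
  \sum_l (if l \in m then inner (haar_coef (x - s) l) (haar_coef (x - s) l)
          else inner (haar_coef s l) (haar_coef s l)).
Proof.
rewrite shat_mE enorm_sq -parseval; apply: eq_bigr => l _.
rewrite !haar_coefB haar_coef_proj; case: ifP => lm; last by rewrite subr0.
by rewrite -opprB innerNl innerNr opprK.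
Qed.

End HaarCoefficients.

(** * Oracle inequality for the exhaustive strategy *)

Section Oracle.
Context {R : realType} {r N : nat}.
Implicit Types (x y t : 'M[R]_(r, 2 ^ N)) (m : {set haar_index N}).

(** The trace of the form is the dimension of the model because the functions
    [haar l] have norm one. *)
Lemma mean_expR_proj_form (s : 'M[R]_(r, 2 ^ N)) m : prob_columns s ->
  mean s (fun f => expR (proj_form m (catmx f - s) (catmx f - s) / 32))
  <= expR (#|m|%:R / 8).
Proof.
move=> ps.
pose A x y := proj_form m x y / 32.
pose dd (i : 'I_(2 ^ N)) : R := (\sum_(l in m) haar l 0 i ^+ 2) / 32.
have sdd : 4 * \sum_i dd i = #|m|%:R / 8.
  rewrite -mulr_suml exchange_big /= (eq_bigr (fun=> 1)); last first.
    move=> l _; transitivity (inner (haar l : 'rV[R]_(2 ^ N)) (haar l)).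
      by rewrite inner_rowE; apply: eq_bigr => i _; rewrite expr2.
    by rewrite haar_orthonormal eqxx.
  by rewrite sumr_const; lra.
rewrite -sdd; apply: (@mean_expR_form _ _ _ A) => //.
- by move=> x y; rewrite /A proj_formC.
- by move=> x y z; rewrite /A proj_formDl mulrDl.
- by move=> a x y; rewrite /A proj_formZl mulrA.
- by move=> x; rewrite divr_ge0// proj_form_ge0.
- by move=> x; have := proj_form_le m x; rewrite /A; lra.
- by move=> i; rewrite divr_ge0// sumr_ge0// => l _; rewrite sqr_ge0.
move=> x i; rewrite /A /dd inner_colpart mulrAC ler_pM2r ?invr_gt0//.
rewrite mulr_suml; apply: ler_sum => l _.
have -> : haar_coef (colpart x i) l = haar l 0 i *: col i x.
  apply/colP => j; rewrite haar_coefE !mxE (bigD1 i)//= big1 ?addr0 => [|k ki].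
    by rewrite !mxE eqxx mulrC.
  by rewrite !mxE (negbTE ki) mul0r.
rewrite innerZl innerZr mulrA -expr2 ler_wpM2l ?sqr_ge0// inner_colE.
by apply: ler_sum => j _; rewrite mxE expr2.
Qed.

(** Level over which the squared projected noises of the models of dimension [D]
    have a summable mean excess: 32 comes from the exponent in [mean_expR_proj_form], and
    68 leaves [expR (- 2 * D)] after the entropy term [ln (n / D)], of which one
    half absorbs the number of models and the other half makes the sum over
    [D] converge. *)
Definition noise_bound (D : nat) : R :=
  D%:R * (32 * ln ((2 ^ N)%:R / D%:R) + 68).

(** One term of the binomial expansion of [(1 + D / n) ^+ n]. *)
Lemma bin_le_expR (n D : nat) : (0 < n)%N ->
  'C(n, D)%:R * (D%:R / n%:R) ^+ D <= expR D%:R :> R.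
Proof.
move=> n0; set t : R := D%:R / n%:R.
have t0 : 0 <= t by rewrite divr_ge0.
have [Dn|nD] := leqP D n; last by rewrite bin_small// mul0r expR_ge0.
have -> : D%:R = t * n%:R :> R by rewrite divfK// pnatr_eq0 -lt0n.
have {2}-> : D = (1 * D)%N by rewrite mul1n.
apply: (@le_trans _ _ ((1 + t) ^+ n)).
  rewrite exprDn (bigD1 (Ordinal (Dn : (D < n.+1)%N)))//= expr1n mul1r mul1n.
  rewrite -[t ^+ D *+ _]mulr_natl lerDl sumr_ge0// => i _.
  by rewrite mulrn_wge0// mulr_ge0 ?exprn_ge0.
rewrite expRM_natr lerXn2r ?nnegrE ?expR_ge0 ?addr_ge0//.
exact: expR_ge1Dx.
Qed.

Lemma sum_expRN (n : nat) : \sum_(1 <= D < n.+1) expR (- D%:R) <= 1 :> R.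
Proof.
have e1 : expR (- 1) <= 2^-1 :> R.
  rewrite expRN lef_pV2 ?posrE ?expR_gt0//.
  by have := expR_ge1Dx (1 : R); lra.
suff : \sum_(1 <= D < n.+1) expR (- D%:R) <= 1 - 2^-1 ^+ n :> R.
  by have : 0 <= 2^-1 ^+ n :> R by []; lra.
elim: n => [|n IH]; first by rewrite big_geq// expr0 subrr.
rewrite big_nat_recr//=.
have : expR (- n.+1%:R) <= 2^-1 ^+ n.+1 :> R.
  by rewrite -mulN1r expRM_natr lerXn2r ?nnegrE ?expR_ge0// invr_ge0.
by rewrite exprS; lra.
Qed.

Lemma noise_bound_expR (D : nat) : (0 < D <= 2 ^ N)%N ->
  'C(2 ^ N, D)%:R * expR (D%:R / 8 - noise_bound D / 32) <= expR (- D%:R).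
Proof.
move=> /andP[D0 Dn].
have n0 : (0 < 2 ^ N)%N by rewrite expn_gt0.
have p1 : 0 < D%:R :> R by rewrite ltr0n.
have p2 : 0 < (2 ^ N)%:R :> R by rewrite ltr0n.
have := bin_le_expR D n0.
set t : R := D%:R / _.
have t0 : 0 < t by rewrite divr_gt0.
have e : expR (D%:R / 8 - noise_bound D / 32) <= t ^+ D * expR (- (2 * D%:R)).
  have -> : t ^+ D = expR (D%:R * ln t).
    by rewrite mulrC expRM_natr lnK.
  rewrite -expRD ler_expR /noise_bound.
  have -> : ln ((2 ^ N)%:R / D%:R) = - ln t :> R.
    by rewrite -lnV ?posrE// invf_div.
  by move: p1; lra.
move=> h; apply: (le_trans (ler_wpM2l (ler0n _ _) e)).
rewrite mulrA; apply: (le_trans (ler_wpM2r (expR_ge0 _) h)).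
by rewrite -expRD ler_expR; lra.
Qed.

Lemma sum_expR_noise :
  \sum_(m : {set haar_index N} | None \in m)
     expR (#|m|%:R / 8 - noise_bound #|m| / 32) <= 1 :> R.
Proof.
pose F (D : nat) : R := expR (D%:R / 8 - noise_bound D / 32).
apply: le_trans (sum_expRN (2 ^ N)).
rewrite (partition_big (fun m : {set haar_index N} => inord #|m| : 'I_(2 ^ N).+1) xpredT) //=.
rewrite big_add1 /= [leRHS]big_mkord.
have im m : (#|m| < (2 ^ N).+1)%N by rewrite ltnS -(@card_haar_index N) max_card.
rewrite big_ord_recl /= big1 ?add0r; last first.
  move=> m /andP[m0 /eqP/(congr1 val)]; rewrite /= inordK// => /eqP.
  by rewrite eqn0Ngt card_gt0 (_ : _ != _)//; apply/set0Pn; exists None.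
apply: ler_sum => D _.
apply: le_trans (noise_bound_expR (D := D.+1) _); last by rewrite /= ltn_ord.
have -> : ('C(2 ^ N, D.+1))%:R = \sum_(m : {set haar_index N}) (#|m| == D.+1)%:R :> R.
  rewrite -{1}(@card_haar_index N) -card_draws -sum1_card natr_sum big_mkcond.
  by apply: eq_bigr => m _; rewrite inE; case: (_ == _).
rewrite mulr_suml big_mkcond; apply: ler_sum => m _.
case: ifP => [/andP[_ /eqP/(congr1 val)]|_]; last by rewrite mulr_ge0 ?expR_ge0.
by rewrite /= inordK// /bump /= add1n => ->; rewrite eqxx mul1r.
Qed.

(** A single nonnegative variable that controls all the models at once, hence
    also the one selected from the data. *)
Definition noise_excess (s x : 'M[R]_(r, 2 ^ N)) : R :=
  \sum_(m : {set haar_index N} | None \in m)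
     Num.max 0 (proj_form m (x - s) (x - s) - noise_bound #|m|).

Lemma noise_excess_le s x m : None \in m ->
  proj_form m (x - s) (x - s) <= noise_bound #|m| + noise_excess s x.
Proof.
move=> m0; rewrite /noise_excess (bigD1 m)//=.
set S := \sum_(_ | _) _.
have : 0 <= S by apply: sumr_ge0 => m' _; rewrite le_max lexx.
have : proj_form m (x - s) (x - s) - noise_bound #|m| <=
  Num.max 0 (proj_form m (x - s) (x - s) - noise_bound #|m|) by rewrite le_max lexx orbT.
by lra.
Qed.

Lemma mean_noise_excess s : prob_columns s ->
  mean s (fun f => noise_excess s (catmx f)) <= 32.
Proof.
move=> ps; rewrite /noise_excess mean_sum.
apply: (@le_trans _ _ (32 * \sum_(m : {set haar_index N} | None \in m)
     expR (#|m|%:R / 8 - noise_bound #|m| / 32))); last first.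
  by have := sum_expR_noise; lra.
rewrite mulr_sumr; apply: ler_sum => m _.
apply: (@le_trans _ _ (mean s (fun f => (32 * expR (- (noise_bound #|m| / 32))) *
    expR (proj_form m (catmx f - s) (catmx f - s) / 32)))).
  apply: ler_mean => // f; rewrite ge_max -mulrA -expRD.
  rewrite mulr_ge0 ?expR_ge0//=.
  have := expR_ge1Dx (- (noise_bound #|m| / 32) +
    proj_form m (catmx f - s) (catmx f - s) / 32).
  by lra.
rewrite meanZ -mulrA ler_pM2l// addrC expRD ler_wpM2l ?expR_ge0//.
exact: mean_expR_proj_form.
Qed.

(** In Haar coordinates the loss of a model sums the squared noise over the
    indices kept and the squared signal over the others; the selection rule
    compares the energies of the observed coefficients. The penalty is at least
    four times [noise_bound], which leaves room for the factors lost in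
    comparing the two, and [224 = 7 * 32]. *)
Lemma EH_oracle (s : 'M[R]_(r, 2 ^ N)) (c1 c2 : R) mhat m :
  prob_columns s -> 128 <= c1 -> 272 <= c2 ->
  penalized_selector (EH_collection N) (EH_space R (N:=N)) (EH_pen c1 c2) mhat ->
  None \in m ->
  mean s (fun f =>
    enorm (s - penalized_estimator (EH_space R (N:=N)) mhat (catmx f)) ^+ 2) <=
  4 * (\sum_(l | l \notin m) inner (haar_coef s l) (haar_coef s l)) +
  3 * EH_pen c1 c2 m + 224.
Proof.
move=> ps h1 h2 sel m0.
set bias := \sum_(l | _) _.
have pen_ge m' : None \in m' ->
    0 <= noise_bound #|m'| /\ 4 * noise_bound #|m'| <= EH_pen c1 c2 m'.
  move=> m'0; rewrite /noise_bound /EH_pen dim_EH_space.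
  have D0 : 0 < #|m'|%:R :> R.
    by rewrite ltr0n card_gt0; apply/set0Pn; exists None.
  have ln0 : 0 <= ln ((2 ^ N)%:R / #|m'|%:R) :> R.
    by rewrite ln_ge0// ler_pdivlMr// mul1r ler_nat -(@card_haar_index N) max_card.
  split; first by rewrite mulr_ge0//; lra.
  rewrite mulrCA ler_pM2l//.
  have : 128 * ln ((2 ^ N)%:R / #|m'|%:R) <= c1 * ln ((2 ^ N)%:R / #|m'|%:R) :> R.
    by rewrite ler_wpM2r.
  by lra.
suff pt f : enorm (s - penalized_estimator (EH_space R (N:=N)) mhat (catmx f)) ^+ 2 <=
    (4 * bias + 3 * EH_pen c1 c2 m) + 7 * noise_excess s (catmx f).
  apply: (le_trans (ler_mean ps pt)); rewrite meanD mean_cst// meanZ.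
  by have := mean_noise_excess ps; lra.
set x := catmx f.
have [mh /(_ m)] := sel x; rewrite !inE in mh * => /(_ m0).
rewrite !contrast_shat /penalized_estimator loss_shat; set m' := mhat x => ineq.
have chim := noise_excess_le s x m0.
have chim' := noise_excess_le s x mh.
have [nb penm] := pen_ge m m0; have [nb' penm'] := pen_ge m' mh.
set loss := \sum_l _.
suff : loss <= 4 * bias + 5 * proj_form m' (x - s) (x - s) + 2 * proj_form m (x - s) (x - s) +
    2 * (proj_form m x x - proj_form m' x x) by lra.
(* the inequality holds index by index: with signal b, noise z and observed
   coefficient b + z, it follows from |b + 2z|^2 >= 0 when the index is only in
   m, and from |b - z|^2 >= 0 when it is only in m' *)
rewrite /loss /bias /proj_form (big_mkcond (fun l => l \notin m)).
rewrite !(big_mkcond (fun l => l \in m)) !(big_mkcond (fun l => l \in m')) -sumrB.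
rewrite !mulr_sumr -!big_split /=; apply: ler_sum => l _.
have -> : haar_coef x l = haar_coef s l + haar_coef (x - s) l.
  by rewrite haar_coefB addrC subrK.
move: (haar_coef s l) (haar_coef (x - s) l) => b z.
have b0 := inner_ge0 b; have z0 := inner_ge0 z.
have p0 := inner_ge0 (b + z); have q0 := inner_ge0 (b + 2 *: z).
have q1 := inner_ge0 (b - z).
move: p0 q0 q1; rewrite !(innerDl, innerDr, innerNl, innerNr, innerZl, innerZr) (innerC z b) => p0 q0 q1.
by case: (l \in m); case: (l \in m'); rewrite /=; lra.
Qed.

End Oracle.

(** * Nonlinear approximation in the Besov class *)

Section Approximation.
Context {R : realType}.

(** Thresholding at the level where the bound [V] allows at most [K]
    exceedances, by Markov's inequality; below the threshold a power [p] of
    each coefficient is kept and the remaining power [2 - p] is bounded. *)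
Lemma level_approx (I : finType) (b : I -> R) (p V K : R) :
  0 < p <= 2 -> 0 < V -> 0 < K -> (forall i, 0 <= b i) ->
  \sum_i b i `^ p <= V ->
  \sum_i ((V / K < b i `^ p)%R%:R : R) <= K /\
  \sum_(i | b i `^ p <= V / K) b i ^+ 2 <= V `^ (2 / p) * K `^ (1 - 2 / p).
Proof.
move=> /andP[p0 p2] V0 K0 b0 hV; have T0 : 0 < V / K by rewrite divr_gt0.
have q1 : 1 <= 2 / p by rewrite ler_pdivlMr// mul1r.
split.
  rewrite -(ler_pM2l T0) divfK ?gt_eqF//; apply: le_trans hV.
  rewrite mulr_sumr; apply: ler_sum => i _.
  by case: ltP => [/ltW h|_]; rewrite ?mulr1// mulr0 powR_ge0.
have -> : V `^ (2 / p) * K `^ (1 - 2 / p) = V * (V / K) `^ (2 / p - 1).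
  rewrite powRM ?invr_ge0 ?ltW// mulrA mulr_powRB1 ?ltW//; last by lra.
  congr (_ * _); rewrite -[K^-1]powR_inv1 ?ltW// -powRrM; congr (_ `^ _); lra.
apply: (@le_trans _ _ (\sum_(i | b i `^ p <= V / K) b i `^ p * (V / K) `^ (2 / p - 1))).
  apply: ler_sum => i bi.
  have -> : b i ^+ 2 = b i `^ p * (b i `^ p) `^ (2 / p - 1).
    rewrite mulr_powRB1 ?powR_ge0//; last by lra.
    by rewrite -powRrM mulrCA divff ?gt_eqF// mulr1 powR_mulrn.
  apply: ler_wpM2l; first exact: powR_ge0.
  by apply: ge0_ler_powR; rewrite ?nnegrE ?powR_ge0 ?(ltW T0) ?subr_ge0.
rewrite -mulr_suml; apply: ler_wpM2r; first exact: powR_ge0.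
apply: le_trans hV; rewrite [leRHS](bigID (fun i => b i `^ p <= V / K))/= lerDl.
by apply: sumr_ge0 => i _; exact: powR_ge0.
Qed.

Lemma sum_haar_index (N : nat) (F : haar_index N -> R) :
  \sum_l F l = F None + \sum_(j < N) \sum_(k < 2 ^ j) F (haar_idx k).
Proof.
rewrite (bigD1 None)//=; congr (_ + _).
rewrite (@reindex_omap _ _ _ _ _ Some id) /=; last by case.
rewrite sig_big_dep /=; apply: eq_big => [[j k]|[j k] _] //.
by rewrite /= eqxx.
Qed.

Lemma sum_geometric_le (q : R) (J N : nat) : 0 < q < 1 ->
  \sum_(j < N | (J <= j)%N) q ^+ (j - J) <= (1 - q)^-1.
Proof.
move=> /andP[q0 q1].
suff h : \sum_(j < N | (J <= j)%N) q ^+ (j - J) <= (1 - q ^+ (N - J)) / (1 - q).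
  apply: (le_trans h); rewrite -[leRHS]mul1r ler_pM2r ?invr_gt0 ?subr_gt0//.
  by rewrite gerBl exprn_ge0// ltW.
elim: N => [|N IH]; first by rewrite big_ord0 sub0n expr0 subrr mul0r.
rewrite big_mkcond big_ord_recr /= -big_mkcond /=.
case: leqP => JN; last first.
  rewrite addr0; move: IH; have -> : (N - J = 0)%N by lia.
  by have -> : (N.+1 - J = 0)%N by lia.
rewrite subSn// exprS.
have -> : (1 - q * q ^+ (N - J)) / (1 - q) = (1 - q ^+ (N - J)) / (1 - q) + q ^+ (N - J).
  by field; rewrite subr_eq0 gt_eqF.
by rewrite lerD2r.
Qed.

Lemma sum_pow2_lt (J N : nat) :
  \sum_(j < N | (j < J)%N) (2 ^ j)%:R + 1 <= (2 ^ J)%:R :> R.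
Proof.
rewrite -natr_sum -[1]/(1%:R) -natrD ler_nat addn1.
have gs n : (\sum_(j < n) 2 ^ j).+1 = (2 ^ n)%N.
  elim: n => [|n IH]; first by rewrite big_ord0.
  by rewrite big_ord_recr /= -addSn IH expnS mul2n addnn.
have [NJ|/ltnW JN] := leqP N J.
  apply: (@leq_trans (2 ^ N)); last by rewrite leq_exp2l.
  by rewrite -gs ltnS big_mkcond leq_sum// => j _; case: ifP.
by rewrite -gs ltnS (big_ord_widen N (fun j => 2 ^ j)%N).
Qed.

(** Sum of the geometric series of ratio [2 `^ (- x)]. *)
Definition approx_const (x : R) : R := (1 - 2 `^ (- x))^-1.

Lemma pow2D (x y : R) : 2 `^ (x + y) = 2 `^ x * 2 `^ y.
Proof. by rewrite powRD// pnatr_eq0 implybT. Qed.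

Lemma pow2_lt1 (x : R) : 0 < x -> 0 < 2 `^ (- x) < 1.
Proof.
move=> x0; rewrite powR_gt0//= /powR pnatr_eq0/= -[ltRHS]expR0 ltr_expR.
by rewrite mulNr oppr_lt0 mulr_gt0//; apply: ln_gt0; rewrite (ltr_nat _ 1 2).
Qed.

(** All the coefficients below level [J] are kept. At a level [j >= J] at most
    [2^J 2^(-delta (j - J))] coefficients are kept by thresholding, with
    [delta = eta * p / 2]: the numbers kept are summable, and [delta] is small
    enough for the biases to decrease geometrically too. *)
Lemma besov_approx (r N J : nat) (L alpha p : R) (s : 'M[R]_(r, 2 ^ N)) :
  0 < L -> 0 < p <= 2 -> p^-1 - 2^-1 < alpha ->
  besov_class L alpha p s ->
  let eta := alpha + 2^-1 - p^-1 in
  exists m : {set haar_index N}, [/\ None \in m,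
    #|m|%:R <= (2 ^ J)%:R * (1 + approx_const (eta * p / 2)) &
    \sum_(l | l \notin m) inner (haar_coef s l) (haar_coef s l) <=
      (2 ^ N)%:R * L ^+ 2 * 2 `^ (- (2 * alpha * J%:R)) * approx_const eta].
Proof.
move=> L0 pp; have /andP[p0 p2] := pp; move=> ha [ps hs] eta.
have eta0 : 0 < eta by rewrite /eta; lra.
set delta := eta * p / 2; have delta0 : 0 < delta by rewrite /delta divr_gt0 ?mulr_gt0.
have n0 : 0 < (2 ^ N)%:R :> R by rewrite ltr0n expn_gt0.
pose b (j : 'I_N) (k : 'I_(2 ^ j)) := enorm (haar_coef s (haar_idx k)).
pose V (j : nat) := (2 ^ N)%:R `^ (p / 2) * L `^ p * 2 `^ (- (j%:R * p * eta)).
(* V j bounds the l^p norm, to the power p, of the coefficients of level j, and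
   K j is the number of coefficients that thresholding may keep there *)
pose K (j : nat) : R := (2 ^ J)%:R * 2 `^ (- delta) ^+ (j - J).
have V0 j : 0 < V j by rewrite /V !mulr_gt0 ?powR_gt0.
have K0 j : 0 < K j by rewrite /K mulr_gt0 ?exprn_gt0 ?powR_gt0 ?ltr0n ?expn_gt0.
have b0 j k : 0 <= b j k by exact: sqrtr_ge0.
have lev (j : 'I_N) : \sum_(k < 2 ^ j) b j k `^ p <= V j.
  rewrite /V powRN ler_pdivlMr ?powR_gt0// mulrC; apply: le_trans hs.
  rewrite [leRHS](bigD1 j)//= lerDl; apply: sumr_ge0 => i _.
  by rewrite mulr_ge0 ?powR_ge0// sumr_ge0// => k _; exact: powR_ge0.
have la (j : 'I_N) := level_approx pp (V0 j) (K0 j) (b0 j) (lev j).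
pose m : {set haar_index N} := finset (fun l : haar_index N => match l with None => true
  | Some u => (tag u < J)%N ||
      (V (tag u) / K (tag u) < b (tag u) (tagged u) `^ p) end).
exists m; split; first by rewrite inE.
  have -> : #|m|%:R = \sum_l (l \in m)%:R :> R.
    rewrite -sum1_card natr_sum big_mkcond; apply: eq_bigr => l _.
    by case: (l \in m).
  rewrite sum_haar_index inE /=.
  apply: (@le_trans _ _ (1 + (\sum_(j < N | (j < J)%N) (2 ^ j)%:R +
      \sum_(j < N | (J <= j)%N) K j))).
    rewrite lerD2l; rewrite [leRHS](_ : _ =
      \sum_(j < N) (if (j < J)%N then (2 ^ j)%:R else K j)); last first.
      rewrite [RHS](bigID (fun j : 'I_N => (j < J)%N))/=; congr (_ + _).
        by apply: eq_bigr => j ->.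
      by apply: eq_big => [j|j h]; [rewrite leqNgt|rewrite ltnNge h].
    apply: ler_sum => j _; case: ifP => jJ.
      rewrite (eq_bigr (fun=> 1)) ?sumr_const ?card_ord//.
      by move=> k _; rewrite inE /= jJ.
    have [+ _] := la j; apply: le_trans; apply: ler_sum => k _.
    by rewrite inE /= jJ.
  rewrite addrA mulrDr mulr1; apply: lerD.
    by rewrite addrC sum_pow2_lt.
  rewrite -mulr_sumr ler_wpM2l// sum_geometric_le// pow2_lt1//.
rewrite big_mkcond sum_haar_index inE /= add0r.
rewrite [leLHS](_ : _ = \sum_(j < N | (J <= j)%N)
    \sum_(k < 2 ^ j | b j k `^ p <= V j / K j) b j k ^+ 2); last first.
  rewrite [RHS]big_mkcond; apply: eq_bigr => j _; case: leqP => jJ.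
    rewrite [RHS]big_mkcond; apply: eq_bigr => k _; rewrite inE /= ltnNge jJ /=.
    by rewrite -leNgt /b enorm_sq.
  by apply: big1 => k _; rewrite inE /= jJ.
apply: (@le_trans _ _ (\sum_(j < N | (J <= j)%N)
   (2 ^ N)%:R * L ^+ 2 * 2 `^ (- (2 * alpha * J%:R)) * 2 `^ (- eta) ^+ (j - J))); last first.
  rewrite -mulr_sumr; apply: ler_wpM2l.
    by rewrite !mulr_ge0 ?powR_ge0 ?sqr_ge0 ?(ltW n0) ?(ltW L0).
  by apply: sum_geometric_le; exact: pow2_lt1.
apply: ler_sum => j Jj; have [_ h] := la j; apply: (le_trans h).
have -> : V j `^ (2 / p) = (2 ^ N)%:R * L ^+ 2 * 2 `^ (- (2 * j%:R * eta)).
  have pi x : p * x * (2 / p) = 2 * x by rewrite mulrCA !mulrA; field; rewrite gt_eqF.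
  rewrite /V !powRM ?mulr_ge0 ?powR_ge0// -!powRrM.
  congr (_ * _ * _).
  - by rewrite (_ : p / 2 * (2 / p) = 1) ?powRr1 ?ltW//; field; rewrite gt_eqF.
  - by rewrite (_ : p * (2 / p) = 2) ?powR_mulrn ?ltW//; field; rewrite gt_eqF.
  - by congr (_ `^ _); field; rewrite gt_eqF.
have G0 : 0 < (2 ^ N)%:R * L ^+ 2 by rewrite mulr_gt0 ?exprn_gt0.
move: (_ * L ^+ 2) G0 => G G0; rewrite -2!(mulrA G); apply: ler_wpM2l; first exact: ltW.
have -> : K j = 2 `^ (J%:R - delta * (j - J)%:R).
  by rewrite /K natrX pow2D powR_mulrn// -[in RHS]mulNr [in RHS]powRrM powR_mulrn ?powR_ge0.
have -> : 2 `^ (- eta) ^+ (j - J) = 2 `^ (- eta * (j - J)%:R).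
  by rewrite powRrM powR_mulrn ?powR_ge0.
rewrite -[(2 `^ (J%:R - _)) `^ _]powRrM -!pow2D.
apply: ler_powR; first by rewrite ler1n.
rewrite natrB//; set i : R := j%:R - J%:R.
have i0 : 0 <= i by rewrite subr_ge0 ler_nat.
have -> : j%:R = i + J%:R :> R by rewrite /i subrK.
have e : (J%:R - delta * i) * (1 - 2 / p) =
   J%:R - 2 * J%:R / p + eta * i - eta * i * (p / 2).
  by rewrite /delta; field; rewrite gt_eqF.
rewrite e.
have : 0 <= eta * i * (p / 2) by rewrite !mulr_ge0 ?divr_ge0 ?(ltW eta0) ?(ltW p0).
by rewrite /eta; lra.
Qed.

(** The map [D |-> D * ln (n / D)] is not monotone, but changing [n / D] into
    [n / 2 ^ J] costs at most [2 ^ J], because [ln x <= x]. *)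
Lemma EH_pen_le (N J : nat) (m : {set haar_index N}) (c1 c2 A : R) :
  (J <= N)%N -> 0 <= c1 -> 0 <= c2 -> 1 <= A -> None \in m ->
  #|m|%:R <= (2 ^ J)%:R * A ->
  EH_pen c1 c2 m <= A * (c1 + c2) * ((2 ^ J)%:R * (1 + ln ((2 ^ N)%:R / (2 ^ J)%:R))).
Proof.
move=> JN c10 c20 A1 m0 mA; rewrite /EH_pen dim_EH_space.
have D0 : 0 < #|m|%:R :> R.
  by rewrite ltr0n card_gt0; apply/set0Pn; exists None.
have J0 : 0 < (2 ^ J)%:R :> R by rewrite ltr0n expn_gt0.
have n0 : 0 < (2 ^ N)%:R :> R by rewrite ltr0n expn_gt0.
set D : R := #|m|%:R in D0 mA *; set y : R := (2 ^ J)%:R in J0 mA *.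
set n : R := (2 ^ N)%:R in n0 *.
have e : ln (n / D) = ln (n / y) + ln (y / D).
  by rewrite !ln_div ?posrE//; lra.
set l := ln (n / y) in e *; have l0 : 0 <= l.
  by rewrite ln_ge0// ler_pdivlMr// mul1r ler_nat leq_exp2l.
have h1 : D * ln (y / D) <= y.
  rewrite mulrC -ler_pdivlMr//; set q := y / D; have q0 : 0 < q by rewrite divr_gt0.
  have := @le_ln1Dx R (q - 1); rewrite (_ : 1 + (q - 1) = q); last by ring.
  by move=> /(_ ltac:(lra)); lra.
have h2 : D * l <= y * A * l by rewrite ler_wpM2r.
have h3 : y <= y * A by rewrite ler_peMr// ltW.
rewrite e mulrDr !mulrDr.
have k1 : D * (c1 * l) + D * (c1 * ln (y / D)) <= c1 * (y * A * (1 + l)).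
  have -> : D * (c1 * l) + D * (c1 * ln (y / D)) = c1 * (D * l + D * ln (y / D)) by ring.
  by rewrite ler_wpM2l//; lra.
have k2 : D * c2 <= c2 * (y * A * (1 + l)).
  rewrite mulrC ler_wpM2l//; have : 0 <= y * A * l by rewrite !mulr_ge0//; lra.
  by lra.
by lra.
Qed.

End Approximation.

(** * Minimax lower bound *)

Section TwoPoint.
Context {R : realType} {r n : nat}.

(** Hellinger affinity of the two product laws. *)
Definition affinity (s s' : 'M[R]_(r, n)) : R :=
  \prod_(i < n) \sum_(j < r) Num.sqrt (s j i * s' j i).

(** As a function of [T], the right-hand side has minimum
    [4 * d ^+ 2 * p * q / (p + q)]; the left-hand side minorizes it by
    the arithmetic-geometric inequality and is linear in [A] and [p + q], so
    that it can be summed over the outcomes. *)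
Lemma two_point_ineq (p q A c d T : R) : 0 <= p -> 0 <= q -> A ^+ 2 = p * q ->
  4 * d ^+ 2 * (c * A - c ^+ 2 * (p + q) / 4) <=
  p * (d - T) ^+ 2 + q * (d + T) ^+ 2.
Proof.
move=> p0 q0 Apq.
have [pq0|] := ltP 0 (p + q); last first.
  move=> pq; have [ep eq] : p = 0 /\ q = 0 by split; lra.
  have : A = 0 by apply/eqP; rewrite -sqrf_eq0 Apq ep mul0r.
  by move=> ->; rewrite ep eq; lra.
rewrite -(ler_pM2l pq0).
have h1 := sqr_ge0 ((p + q) * T - d * (p - q)).
have h2 := sqr_ge0 (d * (2 * A - c * (p + q))).
have -> : (p + q) * (4 * d ^+ 2 * (c * A - c ^+ 2 * (p + q) / 4)) =
  4 * d ^+ 2 * A ^+ 2 - (d * (2 * A - c * (p + q))) ^+ 2 by field.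
have -> : (p + q) * (p * (d - T) ^+ 2 + q * (d + T) ^+ 2) =
  4 * d ^+ 2 * (p * q) + ((p + q) * T - d * (p - q)) ^+ 2 by ring.
by rewrite Apq; lra.
Qed.

(** [two_point_ineq] summed over the outcomes, with [c] equal to the affinity,
    which is the optimal choice. *)
Lemma two_point (s s' : 'M[R]_(r, n)) (T : {ffun 'I_n -> 'I_r} -> R) (d : R) :
  prob_columns s -> prob_columns s' ->
  2 * d ^+ 2 * affinity s s' ^+ 2 <=
  mean s (fun f => (d - T f) ^+ 2) + mean s' (fun f => (d + T f) ^+ 2).
Proof.
move=> ps ps'; set a := affinity s s'.
pose A (f : {ffun 'I_n -> 'I_r}) := \prod_(i < n) Num.sqrt (s (f i) i * s' (f i) i).
have s0 j i : 0 <= s j i by have [+ _] := ps i.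
have s'0 j i : 0 <= s' j i by have [+ _] := ps' i.
have A2 f : A f ^+ 2 = mass s f * mass s' f.
  rewrite /A /mass -prodrXl -big_split; apply: eq_bigr => i _ /=.
  by rewrite sqr_sqrtr ?mulr_ge0.
have sumA : \sum_f A f = a.
  by rewrite /a /affinity (bigA_distr_bigA (fun i j => Num.sqrt (s j i * s' j i))).
have -> : 2 * d ^+ 2 * a ^+ 2 =
    \sum_f 4 * d ^+ 2 * (a * A f - a ^+ 2 * (mass s f + mass s' f) / 4).
  rewrite -mulr_sumr sumrB -mulr_sumr sumA -mulr_suml -mulr_sumr big_split/=.
  by rewrite !mass_sum1//; field.
rewrite /mean -big_split; apply: ler_sum => f _ /=.
by apply: two_point_ineq; rewrite ?mass_ge0.
Qed.

Lemma prod_1B_ge (I : Type) (l : seq I) (x : I -> R) :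
  (forall i, 0 <= x i <= 1) ->
  1 - \sum_(i <- l) x i <= \prod_(i <- l) (1 - x i).
Proof.
move=> x01; elim: l => [|i l IH]; first by rewrite !big_nil subr0.
rewrite !big_cons; have /andP[xi0 xi1] := x01 i.
have S0 : 0 <= \sum_(j <- l) x j by apply: sumr_ge0 => j _; have /andP[] := x01 j.
have : (1 - x i) * (1 - \sum_(j <- l) x j) <= (1 - x i) * \prod_(j <- l) (1 - x j).
  by rewrite ler_wpM2l// subr_ge0.
have := mulr_ge0 xi0 S0.
by lra.
Qed.
End TwoPoint.

Section Hypercube.
Context {R : realType} {r N : nat}.
Variables (j0 j1 : 'I_r) (J : 'I_N).
Hypothesis j01 : j0 != j1.
Notation cube := {ffun 'I_(2 ^ J) -> bool}.
Implicit Type e : cube.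

Definition two_rows (a b : R) : 'cV[R]_r :=
  \col_j (if j == j0 then a else if j == j1 then b else 0).

(** Uniform law on the categories [j0] and [j1], perturbed in opposite
    directions on these two rows by signed Haar functions of level [J]. *)
Definition cube_point e : 'M[R]_(r, 2 ^ N) :=
  two_rows (Num.sqrt (2 ^ N)%:R / 2) (Num.sqrt (2 ^ N)%:R / 2) *m haar None +
  \sum_(k < 2 ^ J) ((-1) ^+ e k / 4) *: (two_rows 1 (-1) *m haar (haar_idx k)).

Lemma haar_coef_cube e (k : 'I_(2 ^ J)) :
  haar_coef (cube_point e) (haar_idx k) = ((-1) ^+ e k / 4) *: two_rows 1 (-1).
Proof.
rewrite haar_coefD haar_coef_mul /= scale0r add0r haar_coef_sum (bigD1 k)//=.
rewrite haar_coefZ haar_coef_mul eqxx scale1r big1 ?addr0// => k' kk.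
rewrite haar_coefZ haar_coef_mul (_ : (haar_idx k' == haar_idx k) = false) ?scale0r ?scaler0//.
apply/negbTE; apply: contra kk => /eqP kk; apply/eqP.
apply: (@eq_from_Tagged _ (fun j : 'I_N => 'I_(2 ^ j) : Type) J).
by move: kk; rewrite /haar_idx; apply: Some_inj.
Qed.

Lemma haar_coef_cube_neq e (j : 'I_N) (k : 'I_(2 ^ j)) : j != J ->
  haar_coef (cube_point e) (haar_idx k) = 0.
Proof.
move=> jJ; rewrite haar_coefD haar_coef_mul /= scale0r add0r haar_coef_sum.
apply: big1 => k' _; rewrite haar_coefZ haar_coef_mul.
rewrite (_ : (haar_idx k' == haar_idx k) = false) ?scale0r ?scaler0//.
by apply/negP => /eqP -[e1 _]; move: jJ; rewrite e1 eqxx.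
Qed.

Lemma block_lt (i : 'I_(2 ^ N)) : ((i %/ 2 ^ (N - J.+1))./2 < 2 ^ J)%N.
Proof.
rewrite -divn2 -divnMA ltn_divLR ?muln_gt0 ?expn_gt0//.
rewrite -expnSr -expnD; apply: (leq_trans (ltn_ord i)).
by rewrite leq_exp2l//; have := ltn_ord J; lia.
Qed.

Definition block (i : 'I_(2 ^ N)) : 'I_(2 ^ J) := Ordinal (block_lt i).

Definition bump_at e (i : 'I_(2 ^ N)) : R :=
  (-1) ^+ e (block i) / 4 * haar (haar_idx (block i)) 0 i.

Lemma cube_pointE e j i : cube_point e j i =
  two_rows (2^-1 + bump_at e i) (2^-1 - bump_at e i) j 0.
Proof.
have n0 : Num.sqrt (2 ^ N)%:R != 0 :> R.
  by rewrite gt_eqF// sqrtr_gt0 ltr0n expn_gt0.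
have mE (u : 'cV[R]_r) (v : 'rV[R]_(2 ^ N)) : (u *m v) j i = u j 0 * v 0 i.
  by rewrite mxE big_ord1.
have sE c (M : 'M[R]_(r, 2 ^ N)) : (c *: M) j i = c * M j i by rewrite mxE.
rewrite mxE mE summxE (bigD1 (block i))//= sE mE big1 ?addr0; last first.
  move=> k kb; rewrite sE mE haarE.
  rewrite (_ : (_ == k :> nat) = false) ?mul0r ?mulr0//.
  by apply/negbTE; move: kb; apply: contra => /eqP h; apply/eqP/val_inj.
rewrite haar_None /bump_at; move: (haar _ 0 i) => b; rewrite !mxE.
case: eqP => _; last case: eqP => _.
- by field.
- by field.
- by rewrite !mul0r mulr0 addr0.
Qed.

Lemma bump_at_sq e i : bump_at e i ^+ 2 = 2 ^+ J / 2 ^+ N / 16.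
Proof.
rewrite /bump_at haarE /= eqxx mul1r -haar_scale_sq.
move: (haar_scale _) => c; rewrite 3!exprMn !sqrr_sign.
by field.
Qed.

Lemma pow2_ratio : (2 ^+ J / 2 ^+ N : R) <= 1.
Proof.
rewrite ler_pdivrMr ?exprn_gt0// mul1r ler_eXn2l ?ltr1n//.
by apply: ltnW.
Qed.

Lemma sum_two_rows (F : 'I_r -> R) : (forall j, j != j0 -> j != j1 -> F j = 0) ->
  \sum_j F j = F j0 + F j1.
Proof.
move=> F0; rewrite (bigD1 j0)//= (bigD1 j1) 1?eq_sym//= big1 ?addr0//.
by move=> j /andP[]; exact: F0.
Qed.

Lemma two_rowsE a b :
  (two_rows a b j0 0 = a) * (two_rows a b j1 0 = b).
Proof. by split; rewrite mxE eqxx // eq_sym (negbTE j01). Qed.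

Lemma prob_cube e : prob_columns (cube_point e).
Proof.
move=> i; have := bump_at_sq e i; have := pow2_ratio.
move: (_ / _ : R) => q q1 b2; have b4 : -4^-1 <= bump_at e i <= 4^-1.
  by apply/andP; split; nra.
have /andP[bl bu] := b4.
split=> [j|].
  rewrite cube_pointE mxE; case: eqP => _; first by lra.
  by case: eqP => _; lra.
rewrite (sum_two_rows (F := fun j => cube_point e j i)); last first.
  by move=> j /negbTE n0 /negbTE n1; rewrite cube_pointE mxE n0 n1.
by rewrite !cube_pointE !two_rowsE; lra.
Qed.

Definition flip (k : 'I_(2 ^ J)) e : cube :=
  [ffun k' => if k' == k then ~~ e k' else e k'].

Lemma flipK k : involutive (flip k).
Proof.
by move=> e; apply/ffunP => k'; rewrite !ffunE; case: (_ == _); rewrite ?negbK.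
Qed.

(** Changing one sign modifies the law on one block of [2 ^ (N - J)] columns,
    by an amount whose square is of order [2 ^ J / 2 ^ N]; the effects add up
    to the constant [1/4]. *)
Lemma affinity_flip k e :
  3 / 4 <= affinity (cube_point e) (cube_point (flip k e)) ^+ 2.
Proof.
set u : R := 2 ^+ J / 2 ^+ N / 16.
have u1 : 0 <= 4 * u <= 1.
  have := pow2_ratio; have : 0 <= (2 ^+ J / 2 ^+ N : R) by rewrite divr_ge0 ?exprn_ge0.
  by rewrite /u; move: (_ / _) => q; lra.
have -> : affinity (cube_point e) (cube_point (flip k e)) ^+ 2 =
    \prod_(i < 2 ^ N) (1 - (block i == k)%:R * (4 * u)).
  rewrite /affinity -prodrXl; apply: eq_bigr => i _.
  rewrite (sum_two_rows (F := fun j => Num.sqrt (cube_point e j i * cube_point (flip k e) j i))); last first.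
    by move=> j /negbTE n0 /negbTE n1; rewrite !cube_pointE !mxE n0 n1 mul0r sqrtr0.
  have [bk|bk] := eqVneq (block i) k.
    have fl : bump_at (flip k e) i = - bump_at e i.
      by rewrite /bump_at ffunE bk eqxx; case: (e k); rewrite /= ?expr0 ?expr1; lra.
    rewrite !cube_pointE !two_rowsE fl opprK.
    rewrite [X in Num.sqrt _ + Num.sqrt X]mulrC; set S := _ * _.
    have b2 := bump_at_sq e i; rewrite -/u in b2.
    have SE : S = 4^-1 - u by rewrite -b2 /S; field.
    have S0 : 0 <= S by rewrite SE; lra.
    rewrite (_ : (_ + _) ^+ 2 = 4 * Num.sqrt S ^+ 2); last by ring.
    by rewrite sqr_sqrtr// SE mul1r; field.
  have fl : bump_at (flip k e) i = bump_at e i.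
    by rewrite /bump_at ffunE (negbTE bk).
  have [p1 _] := prob_cube e i.
  have same j : cube_point (flip k e) j i = cube_point e j i by rewrite !cube_pointE fl.
  have sq a : 0 <= a -> Num.sqrt (a * a) = a :> R.
    by move=> a0; rewrite -expr2 sqrtr_sqr ger0_norm.
  by rewrite !same !sq// !cube_pointE !two_rowsE mul0r subr0; field.
apply: (@le_trans _ _ (1 - \sum_(i < 2 ^ N) (block i == k)%:R * (4 * u))); last first.
  apply: prod_1B_ge => i; case: (_ == _); rewrite ?mul1r// mul0r; lra.
rewrite -mulr_suml.
have -> : \sum_(i < 2 ^ N) (block i == k)%:R = 2 ^+ N / 2 ^+ J :> R.
  by rewrite -(count_block k); apply: eq_bigr => i _; rewrite -val_eqE.
have -> : 2 ^+ N / 2 ^+ J * (4 * u) = 4^-1.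
  rewrite /u; have := expf_neq0 J (_ : 2 != 0 :> R); have := expf_neq0 N (_ : 2 != 0 :> R).
  by rewrite !pnatr_eq0 => /(_ isT) nN /(_ isT) nJ; field; apply/andP.
by lra.
Qed.

(** Assouad's argument: by Bessel's inequality the loss is at least the sum of
    the errors on the [2 ^ J] signed coefficients, and each of these errors is
    bounded below by pairing every vertex with its neighbour. *)
Lemma cube_risk_sum (g : {ffun 'I_(2 ^ N) -> 'I_r} -> 'M[R]_(r, 2 ^ N)) :
  #|{: cube}|%:R * (3 / 64 * 2 ^+ J) <=
  \sum_e mean (cube_point e) (fun f => enorm (cube_point e - g f) ^+ 2).
Proof.
pose T (k : 'I_(2 ^ J)) f : R := haar_coef (g f) (haar_idx k) j0 0.
pose E (k : 'I_(2 ^ J)) e : R :=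
  mean (cube_point e) (fun f => ((-1) ^+ e k / 4 - T k f) ^+ 2).
have bessel e : \sum_(k < 2 ^ J) E k e <=
    mean (cube_point e) (fun f => enorm (cube_point e - g f) ^+ 2).
  rewrite -mean_sum; apply: ler_mean; first exact: prob_cube.
  move=> f; rewrite enorm_sq -parseval sum_haar_index (bigD1 J)//= addrCA.
  rewrite -[leLHS]addr0; apply: lerD.
    apply: ler_sum => k _; rewrite haar_coefB haar_coef_cube inner_colE (bigD1 j0)//=.
    rewrite -[leLHS]addr0; apply: lerD; last first.
      by apply: sumr_ge0 => j _; rewrite -expr2 sqr_ge0.
    have vE (a : R) (u v : 'cV[R]_r) : (a *: u - v) j0 0 = a * u j0 0 - v j0 0.
      by rewrite !mxE.
    by rewrite !vE two_rowsE mulr1 expr2.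
  apply: addr_ge0; first exact: inner_ge0.
  by apply: sumr_ge0 => j _; apply: sumr_ge0 => k _; exact: inner_ge0.
apply: (@le_trans _ _ (\sum_e \sum_(k < 2 ^ J) E k e)); last exact: ler_sum.
rewrite exchange_big /=.
have pair_le k e : 3 / 32 <= E k e + E k (flip k e).
  have := two_point (T k) ((-1) ^+ e k / 4) (prob_cube e) (prob_cube (flip k e)).
  have := affinity_flip k e; set a := _ ^+ 2.
  rewrite !exprMn sqrr_sign => ha h.
  have : mean (cube_point (flip k e)) (fun f => ((-1) ^+ e k / 4 + T k f) ^+ 2) =
      E k (flip k e).
    apply: eq_mean => f; rewrite ffunE eqxx -sqrrN; congr (_ ^+ 2).
    by case: (e k); rewrite /= ?expr0 ?expr1; lra.
  by move=> <-; apply: le_trans h; lra.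
have avg k : #|{: cube}|%:R * (3 / 64) <= \sum_e E k e.
  have h : \sum_e E k (flip k e) = \sum_e E k e.
    by rewrite [RHS](reindex_inj (inv_inj (flipK k))).
  have : \sum_(e : cube) (3 / 32) <= \sum_e (E k e + E k (flip k e)).
    by apply: ler_sum => e _; exact: pair_le.
  rewrite big_split /= h sumr_const -[(3 / 32) *+ _]mulr_natl.
  by lra.
apply: (@le_trans _ _ (\sum_(k < 2 ^ J) #|{: cube}|%:R * (3 / 64))).
  by rewrite sumr_const card_ord -[leRHS]mulr_natr natrX mulrA.
exact: ler_sum.
Qed.

(** Only the coefficients of level [J] enter the Besov sum, and they all have
    norm [Num.sqrt 8^-1 <= 1]. *)
Lemma cube_besov e (L alpha p : R) : 0 < L -> 0 < p <= 2 ->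
  2 `^ (J%:R * (2 * alpha + 1)) <= (2 ^ N)%:R * L ^+ 2 ->
  besov_class L alpha p (cube_point e).
Proof.
move=> L0 /andP[p0 p2] hJ; split; first exact: prob_cube.
have n0 : 0 < (2 ^ N)%:R :> R by rewrite ltr0n expn_gt0.
have p20 : 0 <= p / 2 by rewrite divr_ge0 ?ltW.
rewrite (bigD1 J)//= [X in _ + X]big1 ?addr0; last first.
  move=> j jJ; rewrite big1 ?mulr0// => k _; rewrite haar_coef_cube_neq//.
  by rewrite /enorm inner0l sqrtr0 powR0 ?gt_eqF.
have nrm (k : 'I_(2 ^ J)) : enorm (haar_coef (cube_point e) (haar_idx k)) = Num.sqrt (8^-1).
  rewrite /enorm haar_coef_cube innerZl innerZr inner_colE sum_two_rows; last first.
    by move=> j /negbTE n0' /negbTE n1; rewrite !mxE n0' n1 mul0r.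
  rewrite !two_rowsE mulrA -expr2 exprMn sqrr_sign; congr Num.sqrt; lra.
under eq_bigr do rewrite nrm.
rewrite sumr_const card_ord -[(_ `^ p) *+ _]mulr_natl natrX -powR_mulrn// mulrA -pow2D.
have -> : (2 ^ N)%:R `^ (p / 2) * L `^ p = ((2 ^ N)%:R * L ^+ 2) `^ (p / 2).
  rewrite powRM ?(ltW n0) ?sqr_ge0//; congr (_ * _).
  by rewrite -powR_mulrn ?ltW// -powRrM; congr (_ `^ _); field.
apply: (@le_trans _ _ ((2 `^ (J%:R * (2 * alpha + 1))) `^ (p / 2))); last first.
  apply: ge0_ler_powR => //; rewrite nnegrE ?powR_ge0//.
  by rewrite mulr_ge0 ?sqr_ge0 ?(ltW n0).
rewrite -powRrM.
have -> : J%:R * (2 * alpha + 1) * (p / 2) = J%:R * p * (alpha + 2^-1 - p^-1) + J%:R.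
  by field; rewrite gt_eqF.
rewrite ler_piMr ?powR_ge0//.
rewrite -[leRHS](_ : 1 `^ p = 1); last by rewrite powR1.
apply: ge0_ler_powR; rewrite ?nnegrE ?sqrtr_ge0 ?(ltW p0)//.
by rewrite -[leRHS]sqrtr1 ler_sqrt//; lra.
Qed.
End Hypercube.

Lemma minimax_lower d (Omega : measurableType d) (R : realType) (r N : nat)
    (X : Omega -> 'M[R]_(r, 2 ^ N)) (P : 'M[R]_(r, 2 ^ N) -> probability Omega R)
    (L alpha p : R) (J : 'I_N) :
  categorical_model X P -> (2 <= r)%N -> 0 < L -> 0 < p <= 2 ->
  2 `^ (J%:R * (2 * alpha + 1)) <= (2 ^ N)%:R * L ^+ 2 ->
  ((3 / 64 * 2 ^+ J)%:E <= minimax_risk X P (besov_class L alpha p))%E.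
Proof.
move=> XP r2 L0 pp hJ.
pose j0 : 'I_r := Ordinal (ltnW r2); pose j1 : 'I_r := Ordinal r2.
have j01 : j0 != j1 by [].
apply/ereal_infP => _ [g _ <-].
have [e he] : exists e : {ffun 'I_(2 ^ J) -> bool},
    3 / 64 * 2 ^+ J <= mean (cube_point j0 j1 e)
      (fun f => enorm (cube_point j0 j1 e - g (catmx f)) ^+ 2).
  apply: contrapT => /forallNP no.
  have := cube_risk_sum J j01 (fun f => g (catmx f)); apply/negP; rewrite -ltNge.
  rewrite mulr_natl -sumr_const; apply: ltr_sum; last first.
    by move=> e _; rewrite ltNge; apply/negP; exact: no.
  by apply/hasP; exists [ffun=> true]; rewrite ?mem_index_enum.
apply: (@le_trans _ _ (risk X P g (cube_point j0 j1 e))).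
  rewrite /risk (expectation_mean XP (g := fun x => enorm (cube_point j0 j1 e - g x) ^+ 2)).
  - by rewrite lee_fin.
  - exact: prob_cube.
  - by move=> x; exact: sqr_ge0.
by apply: ereal_sup_ubound; exists (cube_point j0 j1 e) => //; exact: cube_besov.
Qed.

(** * Choice of the resolution and rates *)

(** The substitution [x = expR t] turns the equation into [t * expR t = a],
    whose left-hand side is continuous everywhere. *)
Lemma xlnx_unique_root (R : realType) (a : R) : 0 < a ->
  exists rho : R, unique (fun x : R => 1 < x /\ x * ln x = a) rho.
Proof.
move=> a0; pose f (t : R) := t * expR t.
have fc : {within `[0, a], continuous f}.
  apply: continuous_subspaceT.
  have fT : continuous f by move=> t; apply: cvgM; [exact: cvg_id|exact: continuous_expR].
  exact: fT.
have f0 : f 0 = 0 by rewrite /f mul0r.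
have fa : a <= f a.
  by rewrite /f ler_peMr ?ltW//; have := expR_ge1Dx a; lra.
have [|t] := IVT (ltW a0) fc (v := a).
  by rewrite f0 ge_min le_max fa (ltW a0) orbT.
rewrite in_itv /= => /andP[t0 _] ft.
have tp : 0 < t.
  rewrite lt_neqAle t0 andbT; apply/eqP => e.
  by move: ft; rewrite -e f0 => e0; move: a0; rewrite -e0 ltxx.
have mono (x y : R) : 1 < x -> x < y -> x * ln x < y * ln y.
  move=> x1 xy; have x0 : 0 < x by lra.
  have l0 : 0 < ln x by exact: ln_gt0.
  have : ln x < ln y by rewrite ltr_ln ?posrE//; lra.
  by move: (ln x) (ln y) l0 => u v; nra.
exists (expR t); split.
  by split; [have := expR_gt1 t; rewrite tp|rewrite expRK mulrC].
move=> y [y1 ey].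
have e1 : expR t * ln (expR t) = a by rewrite expRK mulrC.
have t1 : 1 < expR t by rewrite expR_gt1.
have [lt|lt|//] := ltgtP (expR t) y.
  by have := mono _ _ t1 lt; rewrite ey e1 ltxx.
by have := mono _ _ y1 lt; rewrite ey e1 ltxx.
Qed.

Lemma dyadic_floor (R : realType) (N : nat) (x : R) : 1 <= x -> x < (2 ^ N)%:R ->
  exists J : 'I_N, (2 ^ J)%:R <= x < 2 * (2 ^ J)%:R.
Proof.
move=> x1; elim: N => [|N IH] xN; first by move: xN; rewrite expn0; lra.
have [lt|ge] := ltP x (2 ^ N)%:R.
  by have [J hJ] := IH lt; exists (widen_ord (leqnSn N) J).
exists ord_max; rewrite /= ge /=.
by move: xN; rewrite expnS natrM.
Qed.

Section Rate.
Context {R : realType}.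
Variables (alpha L : R) (N : nat).
Local Notation n := ((2 ^ N)%:R : R).
Hypotheses (alpha0 : 0 < alpha) (L0 : 0 < L) (hQ : ln n <= n * L ^+ 2)
  (n1 : 1 < ln n) (hL : L < n `^ alpha).

Local Notation Q := (n * L ^+ 2).
Local Notation ell := (1 + ln (n `^ alpha / L)).
Local Notation a := (2 * alpha + 1).

Let n0 : 0 < n. Proof. by rewrite ltr0n expn_gt0. Qed.
Let Q1 : 1 < Q. Proof. exact: lt_le_trans n1 hQ. Qed.
Let a1 : 1 < a. Proof. by have := alpha0; lra. Qed.

Let lnQ : ln Q = ln n + 2 * ln L.
Proof. by rewrite lnM ?posrE ?exprn_gt0// lnXn// mulr_natl. Qed.

Let ellE : ell = 1 + (alpha * ln n - ln L).
Proof. by rewrite ln_div ?posrE ?powR_gt0// ln_powR. Qed.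

Let lnL : ln L < alpha * ln n.
Proof. by rewrite -ln_powR ltr_ln ?posrE ?powR_gt0. Qed.

Let ell1 : 1 < ell. Proof. by have := lnL; rewrite ellE; lra. Qed.

Let powE (x y : R) : 0 < x -> x `^ y = expR (y * ln x).
Proof. by move=> x0; rewrite /powR gt_eqF. Qed.

Lemma minimax_level : exists J : 'I_N,
  2 `^ (J%:R * a) <= Q /\ Q `^ a^-1 <= 2 * 2 ^+ J.
Proof.
have al0 := alpha0; have aa1 := a1; have np1 := n1; have qq1 := Q1.
have el1 := ell1; have lL := lnL; have hQ' := hQ.
have a0 : 0 < a by lra.
have Q0 : 0 < Q by lra.
have [||J /andP[J1 J2]] := @dyadic_floor R N (Q `^ a^-1).
- rewrite powE ?Q0// -[leLHS]expR0 ler_expR mulr_ge0 ?invr_ge0 ?(ltW a0)//.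
  by rewrite ln_ge0 ?ltW.
- rewrite powE ?Q0// -[ltRHS]lnK ?posrE// ltr_expR mulrC ltr_pdivrMr//.
  by rewrite lnQ; lra.
exists J; split; last by rewrite -natrX; exact: ltW.
rewrite powRrM powR_mulrn// -natrX.
have -> : Q = (Q `^ a^-1) `^ a.
  have aN : a != 0 by rewrite gt_eqF.
  by rewrite -powRrM mulVf// powRr1//; exact: ltW.
by apply: ge0_ler_powR; rewrite ?nnegrE ?powR_ge0 ?(ltW a0).
Qed.

(** The balancing value is [y = (Q / ell) `^ (2 * alpha + 1)^-1]: it makes
    [Q * y `^ (- 2 * alpha)] and [y * ell] equal. It may be smaller
    than 1; the assumption [ln n <= Q] makes [ell <= (alpha + 3/2) * Q], so
    that replacing it by [Num.max y 1] costs only a constant factor. *)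
Lemma upper_level : exists J : 'I_N,
  Q * 2 `^ (- (2 * alpha * J%:R)) <=
     2 `^ (2 * alpha) * (Q `^ a^-1 * ell `^ (2 * alpha / a)) /\
  (2 ^ J)%:R * (1 + ln (n / (2 ^ J)%:R)) <=
     5 * (alpha + 3 / 2) `^ a^-1 * (Q `^ a^-1 * ell `^ (2 * alpha / a)).
Proof.
have al0 := alpha0; have aa1 := a1; have np1 := n1; have qq1 := Q1.
have el1 := ell1; have lL := lnL; have hQ' := hQ.
have a0 : 0 < a by lra.
have Q0 : 0 < Q by lra.
have l0 : 0 < ell by lra.
set y := (Q / ell) `^ a^-1; set g := (alpha + 3 / 2) `^ a^-1.
have q0 : 0 < Q / ell by rewrite divr_gt0.
have y0 : 0 < y by rewrite powR_gt0.
have lny : ln y = (ln Q - ln ell) / a by rewrite ln_powR [ln (Q / _)]ln_div ?posrE// mulrC.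
have lnell0 : 0 < ln ell by exact: ln_gt0.
have lnell : ln ell <= ell by have := @le_ln1Dx R (ell - 1); rewrite (_ : 1 + (ell - 1) = ell); [move=> /(_ ltac:(lra)); lra|ring].
have WE : Q `^ a^-1 * ell `^ (2 * alpha / a) = y * ell.
  have e : 2 * alpha / a = 1 - a^-1 by field; rewrite gt_eqF.
  transitivity (y * expR (ln ell)); last by rewrite lnK.
  rewrite e /y (powE _ Q0) (powE _ l0) (powE _ q0) -!expRD; congr expR.
  by rewrite [ln (Q / _)]ln_div ?posrE//; ring.
have gy : 1 <= g * y.
  rewrite /g /y -powRM ?(ltW q0)//; last by lra.
  have h : 1 <= (alpha + 3 / 2) * (Q / ell).
    rewrite mulrA ler_pdivlMr// mul1r.
    have lnLge : - ln n / 2 <= ln L.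
      have : 0 < ln Q by exact: ln_gt0.
      by rewrite lnQ; lra.
    have : ell <= (alpha + 3 / 2) * ln n by rewrite ellE; lra.
    have : (alpha + 3 / 2) * ln n <= (alpha + 3 / 2) * Q by rewrite ler_wpM2l//; lra.
    by lra.
  rewrite powE; last by lra.
  by rewrite -[leLHS]expR0 ler_expR mulr_ge0 ?invr_ge0 ?(ltW a0)// ln_ge0.
have g1 : 1 <= g.
  rewrite /g powE; last by lra.
  by rewrite -[leLHS]expR0 ler_expR mulr_ge0 ?invr_ge0 ?(ltW a0)// ln_ge0//; lra.
have yn : y < n.
  rewrite -ltr_ln ?posrE// lny ltr_pdivrMr//; rewrite lnQ; lra.
have n1' : 1 < n.
  by rewrite -ltr_ln ?posrE// ln1; lra.
(* 2 ^ J is the dyadic floor of z, hence equals y up to constant factors *)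
set z := Num.max y 1.
have z1 : 1 <= z by rewrite le_max lexx orbT.
have yz : y <= z by rewrite le_max lexx.
have zg : z <= g * y by rewrite ge_max gy andbT ler_peMl// ltW.
have [||J /andP[J1 J2]] := @dyadic_floor R N z => //.
  by rewrite gt_max yn.
exists J; rewrite WE.
have p0 : 0 < (2 ^ J)%:R :> R by rewrite ltr0n expn_gt0.
have lnp : ln y - ln 2 <= ln (2 ^ J)%:R :> R.
  rewrite lerBlDr addrC -lnM ?posrE// ler_ln ?posrE ?mulr_gt0//.
  by apply: ltW; exact: le_lt_trans yz J2.
split.
  have -> : 2 `^ (- (2 * alpha * J%:R)) = expR (- (2 * alpha * ln (2 ^ J)%:R)) :> R.
    by rewrite powE// natrX lnXn// -[ln 2 *+ _]mulr_natr; congr expR; ring.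
  rewrite [2 `^ _]powE//.
  have -> : Q = expR (ln Q) by rewrite lnK.
  have -> : y * ell = expR (ln y) * expR (ln ell) by rewrite !lnK.
  rewrite -!expRD ler_expR.
  have : alpha * (ln y - ln 2) <= alpha * ln (2 ^ J)%:R by rewrite ler_wpM2l// ltW.
  have : ln Q = ln y * a + ln ell by rewrite lny; field; rewrite gt_eqF.
  by move=> ->; lra.
rewrite ln_div ?posrE//.
have ln2 : ln 2 <= 1 :> R.
  by have := @le_ln1Dx R 1; rewrite (_ : 1 + 1 = 2) //; apply; lra.
have k0 : 0 <= 1 + (ln n - ln (2 ^ J)%:R).
  have : ln (2 ^ J)%:R <= ln n.
    rewrite ler_ln ?posrE// ler_nat leq_exp2l//; exact: ltnW.
  by lra.
have k1 : 1 + (ln n - ln (2 ^ J)%:R) <= 5 * ell.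
  have : (ln n - ln y) * a <= 3 * ell.
    rewrite lny mulrBl divfK ?gt_eqF// lnQ; move: lnell; rewrite ellE; lra.
  have : 0 < ln n - ln y by rewrite subr_gt0 ltr_ln ?posrE.
  move=> w0; have : (ln n - ln y) * 1 <= (ln n - ln y) * a.
    by rewrite ler_wpM2l// ltW.
  by lra.
have k2 : (2 ^ J)%:R <= g * y by exact: le_trans J1 zg.
apply: (le_trans (ler_wpM2r k0 k2)).
apply: (le_trans (ler_wpM2l (_ : 0 <= g * y) k1)); first by lra.
by lra.
Qed.

Lemma rate_ge1 : 1 <= Q `^ a^-1 * ell `^ (2 * alpha / a).
Proof.
have al0 := alpha0; have aa1 := a1; have np1 := n1; have qq1 := Q1.
have el1 := ell1; have lL := lnL; have hQ' := hQ.
have a0 : 0 < a by lra.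
have i0 : 0 < a^-1 by rewrite invr_gt0.
have Q0 : 0 < Q by lra.
have l0 : 0 < ell by lra.
have lQ : 0 <= ln Q by rewrite ln_ge0// ltW.
have ll : 0 <= ln ell by rewrite ln_ge0// ltW.
have f0 : 0 <= 2 * alpha / a by rewrite mulr_ge0 ?(ltW i0)//; lra.
rewrite (powE _ Q0) (powE _ l0) -expRD -[leLHS]expR0 ler_expR addr_ge0// mulr_ge0//.
exact: ltW.
Qed.

End Rate.

Definition risk_const {R : realType} (c1 c2 p alpha : R) : R :=
  let eta := alpha + 2^-1 - p^-1 in
  4 * (2 `^ (2 * alpha) * approx_const eta) +
  15 * (1 + approx_const (eta * p / 2)) * (c1 + c2) * (alpha + 3 / 2) `^ (2 * alpha + 1)^-1 +
  224.

Lemma approx_const_ge0 (R : realType) (x : R) : 0 < x -> 0 <= approx_const x.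
Proof.
by move=> /pow2_lt1/andP[_ h]; rewrite /approx_const invr_ge0 subr_ge0 ltW.
Qed.

Lemma EH_risk_le (R : realType) (r N : nat) (L alpha p c1 c2 : R)
    (s : 'M[R]_(r, 2 ^ N)) mhat :
  let n : R := (2 ^ N)%:R in
  0 < L -> 0 < p <= 2 -> p^-1 - 2^-1 < alpha -> 128 <= c1 -> 272 <= c2 ->
  ln n <= n * L ^+ 2 -> 1 < ln n -> L < n `^ alpha ->
  penalized_selector (EH_collection N) (EH_space R (N:=N)) (EH_pen c1 c2) mhat ->
  besov_class L alpha p s ->
  mean s (fun f =>
    enorm (s - penalized_estimator (EH_space R (N:=N)) mhat (catmx f)) ^+ 2) <=
  risk_const c1 c2 p alpha *
    ((n * L ^+ 2) `^ (2 * alpha + 1)^-1 *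
     (1 + ln (n `^ alpha / L)) `^ (2 * alpha / (2 * alpha + 1))).
Proof.
move=> n L0 pp ha h1 h2 hQ n1 hL sel hs; have /andP[p0 p2] := pp.
have p12 : 2^-1 <= p^-1 by rewrite lef_pV2 ?posrE.
have al0 : 0 < alpha by lra.
have eta0 : 0 < alpha + 2^-1 - p^-1 by lra.
have W1 := rate_ge1 al0 L0 hQ n1 hL.
have [J] := upper_level al0 L0 hQ n1 hL; rewrite -/n in W1 *.
set W : R := _ * _ `^ (_ / _) in W1 * => -[b1 b2].
have [m [m0 mA mB]] := besov_approx J L0 pp ha hs.
set eta := alpha + 2^-1 - p^-1 in eta0 mA mB.
have delta0 : 0 < eta * p / 2 by rewrite divr_gt0 ?mulr_gt0.
have B0 := approx_const_ge0 eta0; have A0 := approx_const_ge0 delta0.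
(* 15 is the product of the factor 3 of the penalty in the oracle inequality and
   of the factor 5 in the choice of the level *)
rewrite /risk_const -/eta; set B := approx_const eta in B0 mB *.
set A := 1 + approx_const _ in mA *; set g := (alpha + 3 / 2) `^ _ in b2 *.
have A1 : 1 <= A by rewrite /A; lra.
have JN : (J <= N)%N by exact: ltnW.
have hp := EH_pen_le JN (_ : 0 <= c1) (_ : 0 <= c2) A1 m0 mA.
have {}hp : EH_pen c1 c2 m <= A * (c1 + c2) * (5 * g * W).
  apply: le_trans (hp _ _) _; [lra|lra|].
  by rewrite ler_wpM2l// mulr_ge0; lra.
have {}mB : \sum_(l | l \notin m) inner (haar_coef s l) (haar_coef s l) <=
    2 `^ (2 * alpha) * W * B.
  by apply: (le_trans mB); rewrite ler_wpM2r.
apply: (le_trans (EH_oracle hs.1 h1 h2 sel m0)).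
by lra.
Qed.

(** * The adaptive estimator and the minimax risk *)

Theorem corollary3 (R : realType) :
  exists kappa1 kappa2 : R, [/\ 0 < kappa1, 0 < kappa2 &
  forall c1 c2 p alpha : R,
    kappa1 <= c1 -> kappa2 <= c2 ->
    0 < p <= 2 -> p^-1 - 2^-1 < alpha ->
  exists C : R, 0 < C /\
  exists rho : R, unique (fun x : R => 1 < x /\ x * ln x = 2 * alpha + 1) rho /\
  forall (N r : nat) (L : R),
    (1 <= N)%N -> (2 <= r)%N -> 0 < L ->
    let n : R := (2 ^ N)%:R in
    ln n <= n * L ^+ 2 -> 1 < ln n -> L * Num.sqrt rho < n `^ alpha ->
  forall (d : measure_display) (Omega : measurableType d)
    (X : Omega -> 'M[R]_(r, 2 ^ N))
    (P : 'M[R]_(r, 2 ^ N) -> probability Omega R)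
    (mhat : 'M[R]_(r, 2 ^ N) -> {set haar_index N}),
    categorical_model X P ->
    penalized_selector (EH_collection N) (EH_space R (N:=N)) (EH_pen c1 c2) mhat ->
    (max_risk X P (besov_class L alpha p)
       (penalized_estimator (EH_space R (N:=N)) mhat)
     <= (C * (1 + ln (n `^ alpha / L)) `^ (2 * alpha / (2 * alpha + 1)))%:E
        * minimax_risk X P (besov_class L alpha p))%E].
Proof.
exists 128, 272; split; [by lra|by lra|] => c1 c2 p alpha hc1 hc2 pp ha.
have /andP[p0 p2] := pp.
have p12 : 2^-1 <= p^-1 by rewrite lef_pV2 ?posrE.
have al0 : 0 < alpha by lra.
set C0 := risk_const c1 c2 p alpha.
have C0_gt0 : 0 < C0.
  have eta0 : 0 < alpha + 2^-1 - p^-1 by lra.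
  have B0 := approx_const_ge0 eta0.
  have A0 : 0 <= approx_const ((alpha + 2^-1 - p^-1) * p / 2).
    by apply: approx_const_ge0; rewrite divr_gt0 ?mulr_gt0.
  rewrite /C0 /risk_const ltr_wpDl// addr_ge0//.
    by rewrite !mulr_ge0 ?powR_ge0.
  by rewrite !mulr_ge0 ?powR_ge0//; lra.
have [|rho hrho] := @xlnx_unique_root R (2 * alpha + 1); first by lra.
exists (C0 * (128 / 3)); split; first by rewrite mulr_gt0.
exists rho; split => // N r L N1 r2 L0 n hn n1 hL d Omega X P mhat XP sel.
have {}hL : L < n `^ alpha.
  apply: le_lt_trans hL; rewrite ler_peMr ?(ltW L0)//.
  by rewrite -[leLHS]sqrtr1 ler_sqrt ltW//; have [[]] := hrho; lra.
set l := (1 + _) `^ _; set q := (n * L ^+ 2) `^ (2 * alpha + 1)^-1.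
have [J [J1 J2]] := minimax_level al0 L0 hn n1 hL.
have low := minimax_lower XP r2 L0 pp J1.
apply: (@le_trans _ _ ((C0 * (128 / 3) * l)%:E * (3 / 128 * q)%:E)%E); last first.
  apply: lee_wpmul2l; first by rewrite lee_fin !mulr_ge0 ?powR_ge0// ltW.
  by apply: le_trans low; rewrite lee_fin; move: J2; rewrite -/n -/q; lra.
apply/ereal_supP => _ [s hs <-].
rewrite /risk (expectation_mean XP
  (g := fun x => enorm (s - penalized_estimator (EH_space R (N:=N)) mhat x) ^+ 2)).
- rewrite -EFinM lee_fin.
  apply: le_trans (EH_risk_le L0 pp ha hc1 hc2 hn n1 hL sel hs) _.
  by rewrite -/C0 -/n -/l -/q; lra.
- exact: hs.1.
- by move=> x; exact: sqr_ge0.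
Qed.
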